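(* Let $N\in\mathbb{N}$, $N\ge 3$, and let $\alpha\in(0,3)$, $\alpha\neq 2$. Assume that Hypothesis A (stated in the context) holds for this $\alpha$. Then every configuration of $N-2$ pairwise distinct point vortices, with positions $y=(y_1,\dots,y_{N-2})\in\mathbb{C}^{N-2}\setminus\triangle^{N-2}$ and intensities $\zeta_1,\dots,\zeta_{N-2}\in\mathbb{R}\setminus\{0\}$, admits a burst and admits a collapse of vortices (in the sense defined in the context).
   Context: For $n\ge1$, $\triangle^n\subset\mathbb{C}^n$ denotes the set of points $(z_1,\dots,z_n)$ with $z_j=z_k$ for some $j\ne k$. **Point vortex system.** For $\alpha\in(0,3)$, $\alpha\ne2$, let $c_\alpha=-\left(2^\alpha\,\Gamma(\alpha/2)^2\sin(\alpha\pi/2)\right)^{-1}$. The generalized SQG point vortex system for $n$ vortices with intensities $\xi_1,\dots,\xi_n\in\mathbb{R}\setminus\{0\}$ and pairwise distinct positions $z_1,\dots,z_n\in\mathbb{C}$ is $$\dot{\bar z}_j(t)=i c_\alpha\sum_{k\ne j}\xi_k\frac{|z_j(t)-z_k(t)|^{\alpha-2}}{z_j(t)-z_k(t)},\qquad j=1,\dots,n. \quad (\mathrm{PV})$$ **Burst and collapse.** A configuration of $N-2$ pairwise distinct positions $y=(y_1,\dots,y_{N-2})\in\mathbb{C}^{N-2}\setminus\triangle^{N-2}$ with intensities $\zeta_1,\dots,\zeta_{N-2}\in\mathbb{R}\setminus\{0\}$ *admits a burst* (respectively *a collapse* ) of vortices if there exist $T>0$, intensities $\xi_1,\dots,\xi_N\in\mathbb{R}\setminus\{0\}$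 and a solution $z:(0,T)\to\mathbb{C}^N$ (respectively $z:(-T,0)\to\mathbb{C}^N$) of (PV) with $n=N$ such that $\zeta_j=\xi_j$ for $j=1,\dots,N-3$, $\zeta_{N-2}=\xi_{N-2}+\xi_{N-1}+\xi_N$, and $\lim_{t\to0}z_j(t)=y_j$ for $j=1,\dots,N-3$, $\lim_{t\to0}z_j(t)=y_{N-2}$ for $j=N-2,N-1,N$. **Hypothesis A (for a given $\alpha$).** For every real $\xi\ne0$ there exist distinct $a_1,a_2,a_3\in\mathbb{C}$ with $a_1\neq0$, $\xi_1,\xi_2,\xi_3\in\mathbb{R}\setminus\{0\}$ with $\xi_1+\xi_2+\xi_3=\xi$, and $a,b\in\mathbb{R}$ with $a>0$, such that $$i c_\alpha\sum_{k\neq j}\xi_k\frac{|a_j-a_k|^{\alpha-2}}{a_j-a_k}=\bar a_j(a-ib),\qquad j=1,2,3,$$ and such that all eigenvalues of the matrix $$L=\begin{pmatrix}-a-ib&0&L_{13}&L_{14}\\0&-a-ib&L_{23}&L_{24}\\ \overline{L_{13}}&\overline{L_{14}}&-a+ib&0\\ \overline{L_{23}}&\overline{L_{24}}&0&-a+ib\end{pmatrix}$$ have real part equal to $-a$. Here, with $h(w)=(\alpha-2)|w|^{\alpha-4}-\frac{|w|^{\alpha-2}}{w^2}$ for $w\in\mathbb{C}\setminus\{0\}$, $$L_{13}=-\frac{ic_\alpha}{|a_1|^2}\Big[\overline{a_1^2\xi_3h(a_2-a_3)}+\overline{a_1^2\xi_1h(a_2-a_1)}+\frac{a_2}{a_1}\overline{a_1^2\xi_2h(a_1-a_2)}\Big],$$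 $$L_{14}=-\frac{ic_\alpha}{|a_1|^2}\Big[\overline{a_1^2\xi_3h(a_2-a_3)}+\frac{a_2}{a_1}\overline{a_1^2\xi_3h(a_1-a_3)}\Big],$$ $$L_{23}=-\frac{ic_\alpha}{|a_1|^2}\Big[\overline{a_1^2\xi_2h(a_3-a_2)}+\frac{a_3}{a_1}\overline{a_1^2\xi_2h(a_1-a_2)}\Big],$$ $$L_{24}=-\frac{ic_\alpha}{|a_1|^2}\Big[\overline{a_1^2\xi_2h(a_3-a_2)}+\overline{a_1^2\xi_1h(a_3-a_1)}+\frac{a_3}{a_1}\overline{a_1^2\xi_3h(a_1-a_3)}\Big].$$ *)

(* Defs.v *)
From mathcomp Require Import all_boot all_order all_algebra.
From mathcomp Require Import all_classical all_reals all_analysis.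
From mathcomp Require Import complex.

Set Implicit Arguments.
Unset Strict Implicit.
Unset Printing Implicit Defensive.

Import Order.TTheory GRing.Theory Num.Theory.
Import numFieldNormedType.Exports.

Local Open Scope classical_set_scope.
Local Open Scope complex_scope.
Local Open Scope ring_scope.

Section PointVortices.
Variable R : realType.
Implicit Types (alpha x t : R) (w v : R[i]).

Definition Gamma x : R :=
  \int[lebesgue_measure]_(t in `]0, +oo[) (t `^ (x - 1) * expR (- t)).

Definition c_ alpha : R :=
  - (2 `^ alpha * Gamma (alpha / 2) ^+ 2 * sin (alpha * pi / 2))^-1.

(* |w|^p as a real number; [`|w|] itself has type [R[i]]. *)
Definition cabs_pow w (p : R) : R := ComplexField.Normc.normc w `^ p.

(* [f : R -> C] has derivative [v] at the real time [t]; the limit of the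
   difference quotients is taken in the topology of C given by its norm
   ([R[i]^o]). *)
Definition is_time_derive (f : R -> R[i]) t v : Prop :=
  ((h^-1)%:C * (f (t + h) - f t) : R[i]^o) @[h --> (0 : R)^'] --> (v : R[i]^o).

(* Right-hand side of (PV) for vortex [j]. *)
Definition pv_rhs alpha n (xi : 'I_n -> R) (z : 'I_n -> R[i]) (j : 'I_n)
    : R[i] :=
  'i * (c_ alpha)%:C *
  \sum_(k < n | k != j)
     (xi k)%:C * ((cabs_pow (z j - z k) (alpha - 2))%:C / (z j - z k)).

(* [z] is only constrained on the time interval [D]. *)
Definition pv_solution alpha n (xi : 'I_n -> R) (D : set R)
    (z : R -> 'I_n -> R[i]) : Prop :=
  forall t, D t ->
    injective (z t) /\
    forall j, is_time_derive (fun s => (z s j)^*) t (pv_rhs alpha xi (z t) j).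

(* Indices are 0-based: the vortices N-3, N-2, N-1 of the N-vortex system
   correspond to the last vortex, N-3, of the (N-2)-vortex configuration. *)
Definition splits_intensity N (zeta : 'I_(N - 2) -> R) (xi : 'I_N -> R)
    : Prop :=
  (forall (k : 'I_(N - 2)) (j : 'I_N),
      (k < N - 3)%N -> j = k :> nat -> zeta k = xi j) /\
  (forall k : 'I_(N - 2),
      k = (N - 3)%N :> nat -> zeta k = \sum_(j < N | (N - 3 <= j)%N) xi j).

Definition merges_along N (F : set_system R) (z : R -> 'I_N -> R[i])
    (y : 'I_(N - 2) -> R[i]) : Prop :=
  forall (j : 'I_N) (k : 'I_(N - 2)), k = minn j (N - 3) :> nat ->
    (z t j : R[i]^o) @[t --> F] --> (y k : R[i]^o).

Definition admits_burst alpha N (y : 'I_(N - 2) -> R[i])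
    (zeta : 'I_(N - 2) -> R) : Prop :=
  exists (T : R) (xi : 'I_N -> R) (z : R -> 'I_N -> R[i]),
    [/\ 0 < T,
        forall j, xi j != 0,
        pv_solution alpha xi `]0, T[ z,
        splits_intensity zeta xi &
        merges_along 0^'+ z y].

Definition admits_collapse alpha N (y : 'I_(N - 2) -> R[i])
    (zeta : 'I_(N - 2) -> R) : Prop :=
  exists (T : R) (xi : 'I_N -> R) (z : R -> 'I_N -> R[i]),
    [/\ 0 < T,
        forall j, xi j != 0,
        pv_solution alpha xi `](- T), 0[ z,
        splits_intensity zeta xi &
        merges_along 0^'- z y].

Definition h_ alpha w : R[i] :=
  ((alpha - 2) * cabs_pow w (alpha - 4))%:C
  - (cabs_pow w (alpha - 2))%:C / w ^+ 2.

Section LinearizedMatrix.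
Variables (alpha : R) (a1 a2 a3 : R[i]) (xi1 xi2 xi3 : R).
Local Notation h := (h_ alpha).
Local Notation pref := (- ('i * (c_ alpha)%:C / (cabs_pow a1 2)%:C)).

Definition L13 : R[i] := pref *
  ((a1 ^+ 2 * xi3%:C * h (a2 - a3))^* + (a1 ^+ 2 * xi1%:C * h (a2 - a1))^*
   + a2 / a1 * (a1 ^+ 2 * xi2%:C * h (a1 - a2))^*).

Definition L14 : R[i] := pref *
  ((a1 ^+ 2 * xi3%:C * h (a2 - a3))^*
   + a2 / a1 * (a1 ^+ 2 * xi3%:C * h (a1 - a3))^*).

Definition L23 : R[i] := pref *
  ((a1 ^+ 2 * xi2%:C * h (a3 - a2))^*
   + a3 / a1 * (a1 ^+ 2 * xi2%:C * h (a1 - a2))^*).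

Definition L24 : R[i] := pref *
  ((a1 ^+ 2 * xi2%:C * h (a3 - a2))^* + (a1 ^+ 2 * xi1%:C * h (a3 - a1))^*
   + a3 / a1 * (a1 ^+ 2 * xi3%:C * h (a1 - a3))^*).

Definition Lmx (a b : R) : 'M[R[i]]_4 :=
  let m := (- a) -i* b in   (* -a - ib *)
  let p := (- a) +i* b in   (* -a + ib *)
  \matrix_(i < 4, j < 4) nth 0 (nth [::]
    [:: [:: m;      0;      L13; L14];
        [:: 0;      m;      L23; L24];
        [:: L13^*;  L14^*;  p;   0];
        [:: L23^*;  L24^*;  0;   p]] i) j.

End LinearizedMatrix.

Definition hypothesisA alpha : Prop :=
  forall xi0 : R, xi0 != 0 ->
  exists (q : 'I_3 -> R[i]) (xi : 'I_3 -> R) (a b : R),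
    let q1 := q (inord 0) in let q2 := q (inord 1) in let q3 := q (inord 2) in
    let x1 := xi (inord 0) in let x2 := xi (inord 1) in
    let x3 := xi (inord 2) in
    [/\ injective q /\ q1 != 0,
        (forall j, xi j != 0) /\ x1 + x2 + x3 = xi0,
        0 < a,
        forall j, pv_rhs alpha xi q j = (q j)^* * (a -i* b) &
        forall l : R[i], eigenvalue (Lmx alpha q1 q2 q3 x1 x2 x3 a b) l ->
          complex.Re l = - a].

End PointVortices.

(* Main.v *)
Require Import Defs.
From mathcomp Require Import all_boot all_order all_algebra.
From mathcomp Require Import all_classical all_reals all_analysis.
From mathcomp Require Import complex ring lra zify.

(* Three vortices in the self-similar configuration a_j expand as
   z_j = lam(t) a_j with |lam| = (kappa t)^p, p = 1/(4 - alpha) and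
   kappa = (4 - alpha) a. In the presence of the other vortices we look for a
   solution z_j = y + X + lam (a_j + v_j) with sum_j xi_j v_j = 0. In the time
   log t the equation for v is a perturbation of size O(t^(1-p)) of the linear
   equation obtained by linearizing at a. The conservation laws make the latter
   explicit: with S = sum_j xi_j conj(a_j) v_j, the quantities Re S and
   Im ((a - ib) S), the differentials of the angular impulse and of the
   Hamiltonian, grow like t^(-2p) and t^(1-2p), and on the remaining directions
   v = q a the exponents are -1 (time translation, Re q) and 0 (rotation, Im q).
   All exponents are smaller than 1 - p because alpha < 3, so a contraction
   argument in a ball of radius t^mu, max(0, 1-2p) < mu < 1-p, produces the
   burst. A collapse is the time reversal of the complex conjugate of a burst. *)

Set Implicit Arguments.
Unset Strict Implicit.
Unset Printing Implicit Defensive.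

Import Order.TTheory GRing.Theory Num.Theory.
Import numFieldNormedType.Exports.
Import ComplexField.Normc.

Local Open Scope classical_set_scope.
Local Open Scope complex_scope.
Local Open Scope ring_scope.

(** * Singular linear equations and a singular fixed-point theorem *)

(** In the time log t, which starts at minus infinity, there is no initial value to prescribe; the
    size condition O(t^mu) takes its place. For t m' = s m + G it selects a single solution as soon
    as s < mu, because the homogeneous solution t^s is too large. The sign of s does not matter, so
    decaying, neutral and growing modes are all inverted by the same integral starting at 0. The
    exponent 1 - p arises as follows: the outer vortices give the members of the cluster bounded
    velocities, which are divided by |lam| ~ t^p in the expanding frame and multiplied by t in log
    time. The neutral mode requires p < 1, that is alpha < 3. The obstacle is to find coordinates in
    which the linear part is triangular. Since a > 0, the configuration is centered and has sum_j
    xi_j |a_j|^2 = 0. Hence the directions q a have S = 0, and (q, S) parametrizes all centered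
    displacements. The coupling from S to q is kept, and made small by weighting the coordinates. A
    contraction compares two states, so smoothness of the interaction is needed in its two-point
    (strict) form. *)

Section Primitive.
Variable R : realType.
Implicit Types (f g : R -> R) (x D S M : R).

Definition primitive f x : R := \int[lebesgue_measure]_(y in `]0, x]) f y.

Definition continuous_on0 S f := forall x, 0 < x < S -> {for x, continuous f}.

Lemma bounded_integrable S M f x : x < S -> continuous_on0 S f ->
  (forall y, 0 < y < S -> `|f y| <= M) ->
  lebesgue_measure.-integrable `]0, x] (EFin \o f).
Proof.
move=> xS cf bf; have xin y : y \in `]0, x] -> 0 < y < S.
  by rewrite in_itv /= => /andP[-> /le_lt_trans ->].
apply: measurable_bounded_integrable => //=.
- by rewrite lebesgue_measure_itv /=; case: ifP => _; rewrite ltry.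
- apply: (@measurable_funS _ _ _ _ `]0, S[).
  + exact: measurable_itv.
  + by move=> y /= /xin; rewrite in_itv /=.
  + apply: measurable_realfun.open_continuous_measurable_fun.
      exact: itv_open.
    by move=> y; rewrite inE /= in_itv /= => /cf.
- exists M; split; first exact: num_real.
  move=> B MB y /= /xin /bf /le_trans; apply; exact: ltW.
Qed.

Lemma primitive_derive S M f x : 0 < x < S -> continuous_on0 S f ->
  (forall y, 0 < y < S -> `|f y| <= M) ->
  is_derive x 1 (primitive f) (f x).
Proof.
move=> /andP[x0 xS] cf bf; set u := (x + S) / 2.
have xu : x < u by rewrite /u; lra.
have uS : u < S by rewrite /u; lra.
have [||||df e] := @continuous_FTC1 _ f (BRight 0) x u => //.
- exact: bounded_integrable uS cf bf.
- by apply: cf; rewrite x0.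
- apply: DeriveDef; first exact: df.
  by rewrite -e derive1E.
Qed.

Lemma primitive_dist S M D f g x : 0 < x < S ->
  continuous_on0 S f -> continuous_on0 S g ->
  (forall y, 0 < y < S -> `|f y| <= M) ->
  (forall y, 0 < y < S -> `|g y| <= M) ->
  (forall y, 0 < y < S -> `|f y - g y| <= D) ->
  `|primitive f x - primitive g x| <= D * x.
Proof.
move=> /andP[x0 xS] cf cg bf bg bD.
have If := bounded_integrable xS cf bf; have Ig := bounded_integrable xS cg bg.
have Ifg : lebesgue_measure.-integrable `]0, x] (EFin \o (fun y => f y - g y)).
  apply: (bounded_integrable xS _ bD) => y yS.
  by apply: cvgB; [exact: cf|exact: cg].
rewrite /primitive -RintegralB //.
apply: (@le_trans _ _ (\int[lebesgue_measure]_(y in `]0, x]) `|f y - g y|)).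
  exact: (le_normr_Rintegral _ Ifg).
apply: (@le_trans _ _ (\int[lebesgue_measure]_(y in `]0, x]) (cst D) y));
  last first.
  by rewrite Rintegral_cst //= lebesgue_measure_itv /= lte_fin x0 /= oppr0
    addr0.
apply: le_Rintegral => //.
- exact: integrable_norm Ifg.
- apply: (@bounded_integrable S `|D|) => //.
  by move=> y _; exact: cvg_cst.
- by move=> y /=; rewrite in_itv /= => /andP[y0 yx]; apply: bD;
  rewrite y0 (le_lt_trans yx).
Qed.

Lemma primitive0 x : primitive (fun=> 0) x = 0.
Proof. by rewrite /primitive Rintegral_cst // mul0r. Qed.

End Primitive.

Section PowerCalculus.
Variable R : realType.
Implicit Types (f g : R -> R) (x t p d : R).

Lemma is_derive_continuous f x d : is_derive x 1 f d -> {for x, continuous f}.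
Proof.
move=> df; apply: differentiable_continuous; apply/derivable1_diffP.
exact: ex_derive.
Qed.

Lemma is_derive_ext f g x d e : (forall y, f y = g y) -> d = e ->
  is_derive x 1 f d -> is_derive x 1 g e.
Proof. by move=> /funext -> ->. Qed.

Lemma continuous_powR p x : 0 < x -> {for x, continuous (@powR R ^~ p)}.
Proof. by move=> x0; apply: is_derive_continuous (is_derive1_powR p x0). Qed.

Lemma powRrV x p : 0 < x -> p != 0 -> (x `^ p) `^ (p^-1) = x.
Proof. by move=> x0 p0; rewrite -powRrM mulfV // powRr1 // ltW. Qed.

Lemma powRVr x p : 0 < x -> p != 0 -> (x `^ (p^-1)) `^ p = x.
Proof. by move=> x0 p0; rewrite -powRrM mulVf // powRr1 // ltW. Qed.

Lemma ltr_powR p x t : 0 < p -> 0 < x -> x < t -> x `^ p < t `^ p.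
Proof.
by move=> p0 x0 xt; apply: gt0_ltr_powR; rewrite // nnegrE ltW // (lt_trans x0).
Qed.

Lemma powR_add x p t : 0 < x -> x `^ (p + t) = x `^ p * x `^ t.
Proof. by move=> x0; rewrite powRD // (gt_eqF x0) implybT. Qed.

End PowerCalculus.

(** * Inversion of t d/dt - s on functions of prescribed size at 0 *)

Section SingularLinear.
Variable R : realType.
Implicit Types (s c t T M k : R) (G H : R -> R).

(** The integrand of t^s times the integral of tau^(-s-1) G(tau), after the substitution y = tau^c,
    for which d tau / tau = dy / (c y). *)
Let density s c G y : R := c^-1 * (G (y `^ c^-1) * y `^ (- ((s + c) / c))).

(* The solution of [t m' = s m + G] that is [O(t^(s+c))]. Integrating in the
   variable [y = t^c] instead of [t] makes the integrand bounded near [0]. *)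
Definition singular_sol s c G t : R := t `^ s * primitive (density s c G) (t `^
  c).

Let density_cont s c T G : 0 < c -> 0 < T -> continuous_on0 T G ->
  continuous_on0 (T `^ c) (density s c G).
Proof.
move=> c0 T0 cG y /andP[y0 yT].
have ci0 : 0 < c^-1 by rewrite invr_gt0.
apply: cvgM; first exact: cvg_cst.
apply: cvgM; last exact: continuous_powR.
apply: (@continuous_comp _ _ _ (fun y => y `^ c^-1) G).
  exact: continuous_powR.
apply: cG; rewrite powR_gt0 //=.
by rewrite -[ltRHS](powRrV T0 (lt0r_neq0 c0)) ltr_powR.
Qed.

Let density_dist s c T k G H : 0 < c -> 0 < T ->
  (forall t, 0 < t < T -> `|G t - H t| <= c * k * t `^ (s + c)) ->
  forall y, 0 < y < T `^ c -> `|density s c G y - density s c H y| <= k.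
Proof.
move=> c0 T0 GH y /andP[y0 yT].
have ci0 : 0 < c^-1 by rewrite invr_gt0.
have tT : 0 < y `^ c^-1 < T.
  rewrite powR_gt0 //= -[ltRHS](powRrV T0 (lt0r_neq0 c0)) ltr_powR //.
have := GH _ tT; rewrite -powRrM [c^-1 * _]mulrC => {}GH.
rewrite /density -mulrBr -mulrBl !normrM gtr0_norm //
  (gtr0_norm (powR_gt0 _ y0)).
rewrite powRN ler_pdivrMl // ler_pdivrMr ?powR_gt0 //.
Qed.

Lemma singular_sol0 s c t : singular_sol s c (fun=> 0) t = 0.
Proof.
rewrite /singular_sol (_ : density _ _ _ = fun=> 0) ?primitive0 ?mulr0 //.
by apply/funext => y; rewrite /density mul0r mulr0.
Qed.

Let density_bound s c T M G : 0 < c -> 0 < T ->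
  (forall t, 0 < t < T -> `|G t| <= M * t `^ (s + c)) ->
  forall y, 0 < y < T `^ c -> `|density s c G y| <= c^-1 * M.
Proof.
move=> c0 T0 bG y yT.
have -> : density s c G y = density s c G y - density s c (fun=> 0) y.
  by rewrite /density mul0r mulr0 subr0.
apply: (density_dist c0 T0 _ yT) => t tT.
by rewrite subr0 mulrA mulfV ?gt_eqF // mul1r bG.
Qed.

(** Inverting t d/dt - s divides the sup norm of weight t^(s+c) by [c], the gap between the exponent
    [s] and the imposed size; hence the factor [c] in front of [k]. The constant [M] serves
    integrability. *)
Lemma singular_sol_dist s c T M k G H : 0 < c -> 0 < T ->
  continuous_on0 T G -> continuous_on0 T H ->
  (forall t, 0 < t < T -> `|G t| <= M * t `^ (s + c)) ->
  (forall t, 0 < t < T -> `|H t| <= M * t `^ (s + c)) ->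
  (forall t, 0 < t < T -> `|G t - H t| <= c * k * t `^ (s + c)) ->
  forall t, 0 < t < T ->
    `|singular_sol s c G t - singular_sol s c H t| <= k * t `^ (s + c).
Proof.
move=> c0 T0 cG cH bG bH GH t /andP[t0 tT].
have tc : 0 < t `^ c < T `^ c by rewrite powR_gt0 //= ltr_powR.
rewrite /singular_sol -mulrBr normrM gtr0_norm ?powR_gt0 // powR_add // mulrCA.
rewrite ler_pM2l ?powR_gt0 //.
by apply: (primitive_dist tc (density_cont c0 T0 cG) (density_cont c0 T0 cH)
  (density_bound c0 T0 bG) (density_bound c0 T0 bH)); exact: density_dist.
Qed.

Lemma singular_sol_bound s c T k G : 0 < c -> 0 < T ->
  continuous_on0 T G ->
  (forall t, 0 < t < T -> `|G t| <= c * k * t `^ (s + c)) ->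
  forall t, 0 < t < T -> `|singular_sol s c G t| <= k * t `^ (s + c).
Proof.
move=> c0 T0 cG bG t tT.
rewrite -[singular_sol s c G t]subr0 -(singular_sol0 s c t).
apply: (singular_sol_dist c0 T0 cG _ bG) => //.
- by move=> u _; exact: cvg_cst.
- by move=> u uT; rewrite normr0 (le_trans _ (bG u uT)).
- by move=> u uT; rewrite subr0 bG.
Qed.

Lemma singular_sol_derive s c T M G : 0 < c -> 0 < T ->
  continuous_on0 T G ->
  (forall t, 0 < t < T -> `|G t| <= M * t `^ (s + c)) ->
  forall t, 0 < t < T ->
    is_derive t 1 (singular_sol s c G) ((s * singular_sol s c G t + G t) / t).
Proof.
move=> c0 T0 cG bG t /andP[t0 tT].
have tc : 0 < t `^ c < T `^ c by rewrite powR_gt0 //= ltr_powR.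
have dp := primitive_derive tc (density_cont c0 T0 cG) (density_bound c0 T0 bG).
have dq := is_derive1_comp (g := @powR R ^~ c) dp (is_derive1_powR c t0).
have ds := is_deriveM (is_derive1_powR s t0) dq.
apply: is_derive_ext ds => //.
rewrite /singular_sol /= /density powRrV ?gt_eqF // -powRrM -[_ *: _]/(_ * _).
rewrite -[X in _ + X]/(_ * _).
(* By the chain rule the new term is t^s t^(-s-c) t^c G(t) / t, that is G(t) / t. *)
have -> : c * - ((s + c) / c) = - s + - c by field; rewrite gt_eqF.
rewrite !powR_add // powR_inv1 ?ltW // !powRN.
by field; rewrite !gt_eqF ?powR_gt0.
Qed.

End SingularLinear.

Section GeometricLimit.
Variable R : realType.

Lemma half_exp_lt (C e : R) : 0 < e -> exists n : nat, C * 2^-1 ^+ n < e.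
Proof.
move=> e0; have [C0|C0] := leP C 0.
  by exists 0%N; rewrite expr0 mulr1 (le_lt_trans C0).
exists (Num.bound (C / e)); rewrite exprVn ltr_pdivrMr ?exprn_gt0 //.
rewrite mulrC -ltr_pdivrMr //.
apply: (lt_trans (archi_boundP _)); first by rewrite divr_ge0 ?ltW.
by rewrite -natrX ltr_nat ltn_expl.
Qed.

Lemma le_half_exp (a b C : R) : (forall n : nat, a <= b +
  C * 2^-1 ^+ n) -> a <= b.
Proof.
move=> h; rewrite leNgt; apply/negP => ba.
have [n] : exists n : nat, C * 2^-1 ^+ n < a - b.
  by apply: half_exp_lt; rewrite subr_gt0.
by have := h n; lra.
Qed.

(** The intervals of radius [B n] around [u n] have a common point, the supremum of their left ends.
    This gives the rate of convergence together with the limit. *)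
Lemma half_exp_limit (u : nat -> R) (C : R) : 0 <= C ->
  (forall n, `|u n.+1 - u n| <= C * 2^-1 ^+ n) ->
  exists x, forall n, `|x - u n| <= 2 * C * 2^-1 ^+ n.
Proof.
move=> C0 hu; pose B n := 2 * C * 2^-1 ^+ n.
have B0 n : 0 <= B n by rewrite !mulr_ge0 // exprn_ge0 // invr_ge0.
(* [B n] is the tail of the geometric series of bounds; keeping a difference of two tails lets the
   induction telescope. *)
have hB n k : `|u (n + k)%N - u n| <= B n - B (n + k)%N.
  elim: k => [|k IH]; first by rewrite addn0 !subrr normr0.
  have := hu (n + k)%N; move: IH.
  rewrite /B addnS exprS !ler_norml => /andP[h1 h2] /andP[h3 h4].
  by apply/andP; split; lra.
have hle n k : u n - B n <= u k + B k.
  case: (leqP n k) => [/subnKC|/ltnW/subnKC] <-.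
    have := hB n (k - n)%N; have := B0 (n + (k - n))%N.
    by rewrite ler_norml => h0 /andP[h1 h2]; lra.
  have := hB k (n - k)%N; have := B0 (k + (n - k))%N.
  by rewrite ler_norml => h0 /andP[h1 h2]; lra.
pose A := range (fun n => u n - B n).
have Aub k : ubound A (u k + B k) by move=> _ [n _ <-]; exact: hle.
exists (sup A) => n; rewrite ler_norml; apply/andP; split.
  have : u n - B n <= sup A by apply: ub_le_sup;
    [exists (u 0%N + B 0%N)|exists n].
  by rewrite -/(B n); lra.
have : sup A <= u n + B n by apply: ge_sup => //; exists (u n - B n), n.
by rewrite -/(B n); lra.
Qed.

End GeometricLimit.

(** * Contraction argument for t m' = s m + N(t, m) *)

Section SingularODE.
Variables (R : realType) (J : Type) (s K : J -> R) (mu T : R).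
Variable N : J -> R -> (J -> R) -> R.

Definition box (t : R) (m : J -> R) := forall j, `|m j| <= K j * t `^ mu.

Hypothesis T_gt0 : 0 < T.
Hypothesis s_lt : forall i, s i < mu.
Hypothesis K_gt0 : forall i, 0 < K i.
Hypothesis N_zero : forall i t, 0 < t < T ->
  `|N i t (fun=> 0)| <= (mu - s i) * (2^-1 * K i) * t `^ mu.
Hypothesis N_lip : forall i t m m' D, 0 < t < T -> 0 <= D -> box t m
  -> box t m' ->
  (forall j, `|m j - m' j| <= D * K j * t `^ mu) ->
  `|N i t m - N i t m'| <= (mu - s i) * (D * 2^-1 * K i) * t `^ mu.
Hypothesis N_cont : forall i t (m : R -> J -> R), 0 < t < T -> box t (m t) ->
  (forall j, {for t, continuous (m^~ j)}) ->
  {for t, continuous (fun u => N i u (m u))}.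

Let c i := mu - s i.
Let c_gt0 i : 0 < c i. Proof. by rewrite subr_gt0. Qed.
Let scE i : s i + c i = mu. Proof. by rewrite /c addrC subrK. Qed.

Let good (m : R -> J -> R) :=
  (forall t, 0 < t < T -> box t (m t)) /\ forall i, continuous_on0 T (m^~ i).

Let step (m : R -> J -> R) t i := singular_sol (s i) (c i) (fun u => N i u (m
  u)) t.

Let zero_box t : box t (fun=> 0).
Proof. by move=> j; rewrite normr0 mulr_ge0 ?powR_ge0 // ltW. Qed.

Let zero_good : good (fun _ _ => 0).
Proof. by split=> [t _|i t _]; [exact: zero_box|exact: cvg_cst]. Qed.

Let rhs_cont m i : good m -> continuous_on0 T (fun u => N i u (m u)).
Proof. by move=> [bm cm] t tT; apply: N_cont => //; [exact: bm|move=> j;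
  exact: cm]. Qed.

Let rhs_bound m i : good m ->
  forall t, 0 < t < T -> `|N i t (m t)| <= c i * K i * t `^ (s i + c i).
Proof.
move=> [bm _] t tT; rewrite scE.
have h : `|N i t (m t) - N i t (fun=> 0)| <= c i * (1 * 2^-1 * K i) * t `^ mu.
  apply: N_lip => //; first exact: bm.
  by move=> j; rewrite subr0 mul1r; exact: bm.
have := N_zero i tT; rewrite -/(c i) => h0.
rewrite -[N i t (m t)](subrK (N i t (fun=> 0)));
  apply: (le_trans (ler_normD _ _)).
apply: (le_trans (lerD h h0)); rewrite le_eqVlt; apply/orP; left; apply/eqP;
  by field.
Qed.

Let step_derive m i t : good m -> 0 < t < T ->
  is_derive t 1 ((step m)^~ i) ((s i * step m t i + N i t (m t)) / t).
Proof.
move=> gm tT.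
exact: (singular_sol_derive (c_gt0 i) T_gt0 (@rhs_cont m i gm) (@rhs_bound m i
  gm) tT).
Qed.

Let step_good m : good m -> good (step m).
Proof.
move=> gm; split=> [t tT i|i t tT].
  rewrite -(scE i).
  exact: (singular_sol_bound (c_gt0 i) T_gt0 (@rhs_cont m i gm) (@rhs_bound m i
    gm) tT).
exact: is_derive_continuous (@step_derive m i t gm tT).
Qed.

Let step_contract m m' D : good m -> good m' -> 0 <= D ->
  (forall t, 0 < t < T -> forall j, `|m t j - m' t j| <= D * K j * t `^ mu) ->
  forall t, 0 < t < T ->
    forall j, `|step m t j - step m' t j| <= D * 2^-1 * K j * t `^ mu.
Proof.
move=> gm gm' D0 h t tT j; rewrite -(scE j).
apply: (singular_sol_dist (c_gt0 j) T_gt0 (@rhs_cont m j gm) (@rhs_cont m' j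
  gm')
  (@rhs_bound m j gm) (@rhs_bound m' j gm') _ tT) => u uT.
rewrite scE; apply: N_lip => //; [exact: gm.1|exact: gm'.1|exact: h].
Qed.

Let it n := iter n step (fun _ _ => 0).

Let it_good n : good (it n).
Proof. by elim: n => [|n IH]; [exact: zero_good|exact: step_good]. Qed.

Let it_dist n t j : 0 < t < T ->
  `|it n.+1 t j - it n t j| <= K j * t `^ mu * 2^-1 ^+ n.
Proof.
move=> tT; have -> : K j * t `^ mu * 2^-1 ^+ n = 2^-1 ^+ n * K j * t `^ mu
  by ring.
elim: n t tT j => [|n IH] t tT j.
  by rewrite expr0 mul1r /= subr0; exact: (step_good zero_good).1.
rewrite exprSr; apply: (step_contract (it_good _) (it_good _) _ IH tT).
by rewrite exprn_ge0 // invr_ge0.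
Qed.

(** Picard iteration of [step], which inverts t d/dt - s coordinate by coordinate. The inverse costs
    1 / (mu - s i), which [N_zero] and [N_lip] compensate. Half of the radius of [box] is spent on
    the value at the zero state and half on the variation, so the box is invariant and [step]
    contracts by 1/2. *)
Lemma singular_ode : exists m : R -> J -> R, forall t, 0 < t < T ->
  box t (m t) /\ forall i, is_derive t 1 (m^~ i) ((s i * m t i +
    N i t (m t)) / t).
Proof.
(* The limit is taken separately for each time and coordinate, and is set to 0 outside ]0, T[. *)
have /choice[x hx] : forall t, exists y : J -> R, 0 < t < T -> forall j n,
    `|y j - it n t j| <= 2 * (K j * t `^ mu) * 2^-1 ^+ n.
  move=> t; have [tT|] := boolP (0 < t < T); last by exists (fun=> 0).
  have /choice[y hy] : forall j, exists y, forall n,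
      `|y - it n t j| <= 2 * (K j * t `^ mu) * 2^-1 ^+ n.
    move=> j; apply: half_exp_limit; first by rewrite mulr_ge0 ?powR_ge0 // ltW.
    by move=> n; exact: it_dist.
  by exists y.
have xbox t : 0 < t < T -> box t (x t).
  move=> tT j; apply: le_half_exp => n.
  rewrite -[x t j](subrK (it n t j)) addrC; apply: (le_trans (ler_normD _ _)).
  by rewrite lerD //; [exact: (it_good n).1|exact: hx].
have xcont i : continuous_on0 T (x^~ i).
  move=> t tT; apply/cvgrPdist_lt => e e0; have [t0 tltT] := andP tT.
  (* [M] bounds u^mu for u near t, so the iterates converge uniformly there and the limit inherits
     their continuity. *)
  pose M := t `^ mu + 1.
  have [n hn] : exists n : nat, 2 * (K i * M) * 2^-1 ^+ n < e / 3.
    by apply: half_exp_lt; rewrite divr_gt0.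
  have nM : \forall u \near t, u `^ mu < M.
    have ct : u `^ mu @[u --> t] --> t `^ mu by exact: continuous_powR.
    by apply: (cvgr_lt _ ct); rewrite ltrDl.
  have close u : 0 < u < T -> u `^ mu < M -> `|x u i - it n u i| < e / 3.
    move=> uT uM; apply: le_lt_trans hn; apply: (le_trans (hx u uT i n)).
    by rewrite ler_wpM2r ?exprn_ge0 ?invr_ge0 // ler_wpM2l // ler_wpM2l ?ltW.
  have cn : it n u i @[u --> t] --> it n t i by exact: (it_good n).2.
  have {}cn : \forall u \near t, `|it n t i - it n u i| < e / 3.
    by move/cvgrPdist_lt : cn; apply; rewrite divr_gt0.
  near=> u.
  have uT : 0 < u < T.
    by apply/andP; split; near: u; [exact: lt_nbhsr|exact: lt_nbhsl].
  have h1 : `|x t i - it n t i| < e / 3 by apply: close => //; rewrite /M ltrDl.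
  have h2 : `|x u i - it n u i| < e / 3 by apply: close => //; near: u.
  have h3 : `|it n t i - it n u i| < e / 3.
    by near: u.
  move: h1 h2 h3; rewrite !ltr_norml => /andP[? ?] /andP[? ?] /andP[? ?].
  by apply/andP; split; lra.
have xgood : good x by [].
(* Both [x] and [step x] lie within a geometric error of the iterate of index n + 1. *)
have xfix t : 0 < t < T -> step x t = x t.
  move=> tT; apply/funext => i; apply/eqP; rewrite -subr_eq0 -normr_le0.
  apply: (@le_half_exp _ _ _ (2 * (K i * t `^ mu))) => n; rewrite add0r.
  have h1 : `|x t i - it n.+1 t i| <= 2 * (K i * t `^ mu) * 2^-1 ^+ n.+1
    by exact: hx.
  have h2 : `|step x t i - it n.+1 t i| <= (2 * 2^-1 ^+ n) * 2^-1 * K i * t `^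
    mu.
    apply: (step_contract xgood (it_good n) _ _ tT).
      by rewrite mulr_ge0 // exprn_ge0 // invr_ge0.
    move=> u uT j; apply: (le_trans (hx u uT j n)).
    by rewrite le_eqVlt; apply/orP; left; apply/eqP; ring.
  move: h1 h2; rewrite exprS.
  set z := _ ^+ n; set w := t `^ mu; rewrite !ler_norml.
  rewrite (_ : 2 * (K i * w) * (2^-1 * z) = K i * w * z); last by field.
  rewrite (_ : 2 * z * 2^-1 * K i * w = K i * w * z); last by field.
  rewrite (_ : 2 * (K i * w) * z = 2 * (K i * w * z)); last by ring.
  by move=> /andP[? ?] /andP[? ?]; apply/andP; split; lra.
(* The witness is [step x], an explicit integral whose derivative is known, rather than the
   pointwise limit [x] that it equals on ]0, T[. *)
exists (step x) => t tT; split; first by rewrite xfix //; exact: xbox.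
by move=> i; rewrite {2}(xfix _ tT); exact: step_derive.
Unshelve. all: by end_near.
Qed.

End SingularODE.

(** * The interaction kernel *)

Section ComplexNorm.
Variable R : realType.
Implicit Types (z w h : R[i]) (r e : R).

Lemma normcE z : `|z| = (normc z)%:C.
Proof. by case: z. Qed.

Lemma normc_ge0 z : 0 <= normc z.
Proof. by case: z => x y; exact: sqrtr_ge0. Qed.

Lemma normcD z w : normc (z + w) <= normc z + normc w.
Proof. exact: le_normcD. Qed.

Lemma normc_conj z : normc z^* = normc z.
Proof. by case: z => x y /=; rewrite sqrrN. Qed.

Lemma normc_real r : normc r%:C = `|r|.
Proof. by rewrite /= expr0n addr0 sqrtr_sqr. Qed.

Lemma conj_real r : (r%:C)^* = r%:C.
Proof. exact: conjc_real. Qed.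

Lemma normc_i : normc ('i : R[i]) = 1.
Proof. by rewrite /= expr0n add0r expr1n sqrtr1. Qed.

Lemma normc_Re z : `|complex.Re z| <= normc z.
Proof.
case: z => x y /=; rewrite -[`|x|]ger0_norm // -sqrtr_sqr ler_wsqrtr //.
by rewrite real_normK ?num_real // lerDl sqr_ge0.
Qed.

Lemma normc_Im z : `|complex.Im z| <= normc z.
Proof.
case: z => x y /=; rewrite -[`|y|]ger0_norm // -sqrtr_sqr ler_wsqrtr //.
by rewrite real_normK ?num_real // lerDr sqr_ge0.
Qed.

Lemma complex_ReIm z : z = (complex.Re z)%:C + 'i * (complex.Im z)%:C.
Proof. exact: complexE. Qed.

Lemma normc_le z : normc z <= `|complex.Re z| + `|complex.Im z|.
Proof.
rewrite {1}(complex_ReIm z) (le_trans (normcD _ _)) //.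
by rewrite normcM normc_i mul1r !normc_real.
Qed.

Lemma normc_gt0 z : z != 0 -> 0 < normc z.
Proof.
move=> z0; rewrite lt0r normc_ge0 andbT; apply: contra z0 => /eqP/eq0_normc.
by move=> ->.
Qed.

Definition sqnorm z : R := complex.Re z ^+ 2 + complex.Im z ^+ 2.
Definition dotc z w : R :=
  complex.Re z * complex.Re w + complex.Im z * complex.Im w.

Lemma sqnormE z : sqnorm z = normc z ^+ 2.
Proof. by case: z => x y; rewrite /sqnorm /= sqr_sqrtr //
  addr_ge0 ?sqr_ge0. Qed.

Lemma sqnorm_gt0 z : z != 0 -> 0 < sqnorm z.
Proof. by move=> z0; rewrite sqnormE exprn_gt0 // normc_gt0. Qed.

Lemma dotc_le z w : `|dotc z w| <= normc z * normc w.
Proof.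
have -> : dotc z w = complex.Re (z^* * w).
  by case: z w => [x y] [x' y']; rewrite /dotc /=; ring.
by rewrite (le_trans (normc_Re _)) // normcM normc_conj.
Qed.

Lemma dotcDl z w h : dotc (z + w) h = dotc z h + dotc w h.
Proof. by case: z w => [x y] [x' y']; rewrite /dotc /=; ring. Qed.

Lemma sqnormB z w : sqnorm z - sqnorm w = dotc (z + w) (z - w).
Proof. by case: z w => [x y] [x' y']; rewrite /sqnorm /dotc /=; ring. Qed.

End ComplexNorm.

(** * Strict differentiability of real powers *)

Section StrictPower.
Variable R : realType.

(** The mean value theorem on the segment between [s] and [t], along which the derivative stays
    within [e] of its value at [n0]. *)
Lemma powR_strict (p n0 e : R) : 0 < n0 -> 0 < e ->
  exists2 d, 0 < d & forall s t, `|s - n0| <= d -> `|t - n0| <= d ->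
    `|s `^ p - t `^ p - p * n0 `^ (p - 1) * (s - t)| <= e * `|s - t|.
Proof.
move=> n00 e0; pose g' x : R := p * x `^ (p - 1).
have cg : g' x @[x --> n0] --> g' n0.
  by apply: cvgM; [exact: cvg_cst|exact: continuous_powR].
move/cvgrPdist_le : cg => /(_ _ e0) /nbhs_ballP[d /= d0 hd].
(* The bound n0 / 2 keeps all points positive, where the power is differentiable; d / 2 puts them
   strictly inside the ball of radius [d]. *)
pose r := Num.min (d / 2) (n0 / 2).
have r0 : 0 < r by rewrite lt_min !divr_gt0.
have close x : `|x - n0| <= r -> 0 < x /\ `|g' n0 - g' x| <= e.
  rewrite le_min => /andP[xd]; rewrite ler_norml => /andP[x1 x2]; split.
    by lra.
  by apply: hd; rewrite /ball /= distrC (le_lt_trans xd) //; lra.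
exists r => //.
wlog st : / forall s t, s <= t -> `|s - n0| <= r -> `|t - n0| <= r ->
    `|s `^ p - t `^ p - p * n0 `^ (p - 1) * (s - t)| <= e * `|s - t|.
  apply=> s t st hs ht.
  move: st; rewrite le_eqVlt => /predU1P[->|st].
    by rewrite !subrr mulr0 subrr !normr0 mulr0.
  have inr x : s <= x <= t -> `|x - n0| <= r.
    move: hs ht; rewrite !ler_norml => /andP[? ?] /andP[? ?] /andP[? ?].
    by apply/andP; split; lra.
  have dg x : x \in `]s, t[ -> is_derive x 1 (@powR R ^~ p) (g' x).
    rewrite in_itv /= => /andP[sx xt]; apply: is_derive1_powR.
    by apply: (close x _).1; apply: inr; rewrite !ltW.
  have [|x xst hx] := MVT_segment (ltW st) dg.
    apply: continuous_in_subspaceT => x; rewrite inE /= in_itv /= => xst.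
    by apply: continuous_powR; exact: (close x (inr x xst)).1.
  rewrite in_itv /= in xst; have [_ xe] := close x (inr x xst).
  rewrite (_ : _ - _ - _ = (g' n0 - g' x) * (t - s)); last first.
    by rewrite mulrBl -hx /g'; ring.
  by rewrite normrM (distrC s) ler_wpM2r.
move=> s t hs ht; have [/st|/ltW/st] := leP s t; first exact.
move=> /(_ ht hs); rewrite distrC [`|t - s|]distrC; congr (_ <= _).
by congr (`| _ |); ring.
Qed.

End StrictPower.

Section Kernel.
Variables (R : realType) (alpha : R).
Implicit Types (z w h : R[i]) (r e d : R).

Let be : R := (alpha - 4) / 2.

(** The interaction |w|^(alpha-2) / w of (PV) without division: the conjugate of w times a real
    power of |w|^2. *)
Definition kernel w : R[i] := w^* * (sqnorm w `^ be)%:C.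

(** The real differential of [kernel] at [w] in the direction [h]; it is not complex linear in
    [h]. *)
Definition dkernel w h : R[i] :=
  h^* * (sqnorm w `^ be)%:C
  + w^* * (be * sqnorm w `^ (be - 1) * (2 * dotc w h))%:C.

Lemma cabs_powE w p : cabs_pow w p = sqnorm w `^ (p / 2).
Proof.
have [->|w0] := eqVneq w 0.
  rewrite /cabs_pow normc0 /sqnorm /= expr0n addr0 /powR eqxx.
  by rewrite mulf_eq0 invr_eq0 pnatr_eq0 orbF.
rewrite /cabs_pow sqnormE -powR_mulrn ?normc_ge0 // -powRrM.
by congr (_ `^ _); field.
Qed.

Lemma sqnorm_conj w : (sqnorm w)%:C = w * w^*.
Proof. by case: w => x y; rewrite /sqnorm /=; simpc; congr (_ +i* _); ring. Qed.

(** This includes w = 0, where the inverse is 0 by convention and the conjugate factor vanishes. *)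
Lemma kernelE w : (cabs_pow w (alpha - 2))%:C / w = kernel w.
Proof.
have [->|w0] := eqVneq w 0; first by rewrite invr0 mulr0 /kernel rmorph0 mul0r.
apply: (mulIf w0); rewrite divfK // cabs_powE /kernel.
have -> : w^* * (sqnorm w `^ be)%:C * w = (sqnorm w * sqnorm w `^ be)%:C.
  by rewrite rmorphM /= sqnorm_conj; ring.
rewrite -{2}[sqnorm w]powRr1 ?ltW ?sqnorm_gt0 // -powR_add ?sqnorm_gt0 //.
by congr ((_ `^ _)%:C); rewrite /be; field.
Qed.

Lemma kernelN w : kernel (- w) = - kernel w.
Proof.
rewrite /kernel rmorphN mulNr; congr (- (_ * (_ `^ _)%:C)).
by case: w => x y; rewrite /sqnorm /= !sqrrN.
Qed.

Lemma kernel_conj w : kernel w^* = (kernel w)^*.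
Proof.
rewrite /kernel rmorphM /= conj_real; congr (_ * (_ `^ _)%:C).
by case: w => x y; rewrite /sqnorm /= sqrrN.
Qed.

Lemma kernelM l w : l != 0 ->
  kernel (l * w) = l^* * (sqnorm l `^ be)%:C * kernel w.
Proof.
move=> l0; have -> : kernel (l * w) =
    (l * w)^* * (sqnorm l `^ be * sqnorm w `^ be)%:C.
  by rewrite -powRM ?sqnormE ?sqr_ge0 // -exprMn -normcM -sqnormE.
by rewrite /kernel !rmorphM /=; ring.
Qed.

Lemma dkernelD w h h' : dkernel w (h + h') = dkernel w h + dkernel w h'.
Proof.
have -> : dkernel w (h + h') = (h + h')^* * (sqnorm w `^ be)%:C
  + w^* * (be * sqnorm w `^ (be - 1) * (2 * (dotc w h + dotc w h')))%:C.
  by rewrite /dkernel /dotc /=; case: h h' => [x y] [x' y'] /=;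
    congr (_ + _ * _%:C); ring.
by rewrite /dkernel; ring.
Qed.

Lemma dkernelZ w (r : R) h : dkernel w (r%:C * h) = r%:C * dkernel w h.
Proof.
have -> : dkernel w (r%:C * h) = (r%:C * h)^* * (sqnorm w `^ be)%:C
  + w^* * (be * sqnorm w `^ (be - 1) * (2 * (r * dotc w h)))%:C.
  by rewrite /dkernel /dotc /=; case: h => [x y] /=; congr (_ + _ * _%:C); ring.
by rewrite rmorphM /= conj_real /dkernel; ring.
Qed.

Lemma dkernelN w h : dkernel w (- h) = - dkernel w h.
Proof.
have -> : dkernel w (- h) = (- h)^* * (sqnorm w `^ be)%:C
  + w^* * (be * sqnorm w `^ (be - 1) * (2 * - dotc w h))%:C.
  by rewrite /dkernel /dotc /=; case: h => [x y] /=; congr (_ + _ * _%:C); ring.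
by rewrite /dkernel; ring.
Qed.

Lemma dkernelB w h h' : dkernel w (h - h') = dkernel w h - dkernel w h'.
Proof. by rewrite dkernelD dkernelN. Qed.

(* [kernel] is homogeneous of degree [alpha - 3] under dilations and
   conjugates phases; this is the infinitesimal version. *)
Lemma dkernel_homogeneous w q : w != 0 ->
  dkernel w (q * w) =
  (((alpha - 3) * complex.Re q)%:C - 'i * (complex.Im q)%:C) * kernel w.
Proof.
move=> w0; rewrite /dkernel /kernel.
have -> : be * sqnorm w `^ (be - 1) * (2 * dotc w (q * w)) =
    2 * be * complex.Re q * sqnorm w `^ be.
  have -> : dotc w (q * w) = complex.Re q * sqnorm w.
    by case: w q {w0} => [x y] [x' y']; rewrite /dotc /sqnorm /=; ring.
  rewrite powR_add ?sqnorm_gt0 // powR_inv1 ?ltW ?sqnorm_gt0 //.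
  by field; rewrite gt_eqF // sqnorm_gt0.
have -> : 2 * be = alpha - 4 by rewrite /be; field.
by case: q w {w0} => [x y] [x' y']; move: (_ `^ _) => g; apply/eqP;
  rewrite eq_complex /=; apply/andP; split; apply/eqP; ring.
Qed.

(* The kernel is, up to the factor [i], the gradient of a radial potential. *)
Lemma dkernel_sym w h h' :
  complex.Re (h * dkernel w h') = complex.Re (h' * dkernel w h).
Proof.
rewrite /dkernel /dotc; case: h h' w => [x y] [x' y'] [u v] /=; ring.
Qed.

(** Derivative in the direction [h] of the identity Im (w kernel w) = 0, which says that the force
    is central. *)
Lemma dkernel_momentum w h :
  complex.Im (w * dkernel w h) = - complex.Im (h * kernel w).
Proof.
rewrite /dkernel /kernel /dotc; case: h w => [x y] [u v] /=; ring.
Qed.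

Lemma normc_dkernel w h :
  normc (dkernel w h) <=
  (sqnorm w `^ be + normc w ^+ 2 * 2 * `|be * sqnorm w `^ (be - 1)|) * normc h.
Proof.
rewrite mulrDl; apply: (le_trans (normcD _ _)); apply: lerD.
  by rewrite normcM normc_conj normc_real mulrC ger0_norm ?powR_ge0.
rewrite normcM normc_conj normc_real normrM; set g := `|be * _|.
have -> : normc w ^+ 2 * 2 * g * normc h = normc w * (g * (2 * (normc w * normc
  h))) by ring.
rewrite !ler_wpM2l ?normc_ge0 ?[0 <= g]normr_ge0 // normrM (@ger0_norm _ 2) //
  ler_wpM2l //.
exact: dotc_le.
Qed.

(** Applied to two states at once, this makes the Taylor remainder Lipschitz with an arbitrarily
    small constant, where a one-point expansion would only bound its size. *)
Lemma kernel_strict w0 e : w0 != 0 -> 0 < e ->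
  exists2 d, 0 < d & forall w w', normc (w - w0) <= d -> normc (w' - w0) <= d ->
    normc (kernel w - kernel w' - dkernel w0 (w - w')) <= e * normc (w - w').
Proof.
move=> w00 e0; have n00 := sqnorm_gt0 w00.
pose A := normc w0; have A0 : 0 < A by exact: normc_gt0.
pose g n : R := n `^ be; pose g1 := be * sqnorm w0 `^ (be - 1).
(* [M1] collects what multiplies [e'] (bound [B2]) and [M2] what multiplies [d] (bounds [B1] and
   [B3]); each product is then made at most e / 2. The condition (2 A + 1) d <= d' keeps the squared
   moduli where [powR_strict] applies. *)
pose M1 := (A + 1) * (2 * A + 2).
pose M2 := (`|g1| + 1) * (2 * A + 1) + `|g1| * (4 * A + 2).
have M10 : 0 < M1 by rewrite /M1; nra.
have M20 : 0 < M2 by rewrite /M2; have := normr_ge0 g1; nra.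
have M1P : 0 < 2 * M1 by rewrite pmulr_rgt0.
have M2P : 0 < 2 * M2 by rewrite pmulr_rgt0.
pose e' := Num.min 1 (e / (2 * M1)).
have e'0 : 0 < e' by rewrite lt_min ltr01 /= pmulr_rgt0 // invr_gt0.
have [d' d'0 hd] := powR_strict be n00 e'0.
pose d := Num.min (Num.min 1 (e / (2 * M2))) (d' / (2 * A + 1)).
have d0 : 0 < d.
  rewrite !lt_min ltr01 /= pmulr_rgt0 // invr_gt0 M2P /=.
  by rewrite divr_gt0 //; lra.
have [d1 d2 d3] : [/\ d <= 1, M2 * d <= e / 2 & (2 * A + 1) * d <= d'].
  have : d <= d by []; rewrite {2}/d !le_min => /andP[/andP[-> h2] h3];
    split => //.
    move: h2; rewrite ler_pdivlMr // => h2; lra.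
  by rewrite mulrC -ler_pdivlMr //; lra.
have [e'1 e'2] : e' <= 1 /\ M1 * e' <= e / 2.
  have : e' <= e' by []; rewrite {2}/e' le_min => /andP[-> h2]; split => //.
  move: h2; rewrite ler_pdivlMr // => h2; lra.
have nclose w : normc (w - w0) <= d -> `|sqnorm w - sqnorm w0| <= (2 * A +
  1) * normc (w - w0).
  move=> wd; rewrite sqnormB (le_trans (dotc_le _ _)) //
    ler_wpM2r ?normc_ge0 //.
  have -> : w + w0 = (w - w0) + (w0 + w0) by ring.
  rewrite (le_trans (normcD _ _)) // (le_trans (lerD wd (normcD _ _))) //.
  by rewrite -/A; lra.
exists d => // w w' wd wd'.
set h := w - w'; have h0 : 0 <= normc h := normc_ge0 h.
have k0 : 0 <= 2 * A + 1 by lra.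
have nw := nclose _ wd; have nw' := nclose _ wd'.
have nwd : `|sqnorm w - sqnorm w0| <= d' by rewrite (le_trans nw) //
  (le_trans _ d3) // ler_wpM2l.
have nwd' : `|sqnorm w' - sqnorm w0| <= d' by rewrite (le_trans nw') //
  (le_trans _ d3) // ler_wpM2l.
have n0d : `|sqnorm w0 - sqnorm w0| <= d' by rewrite subrr normr0 ltW.
have dww : `|sqnorm w - sqnorm w'| <= (2 * A + 2) * normc h.
  rewrite sqnormB (le_trans (dotc_le _ _)) // ler_wpM2r //.
  have -> : w + w' = (w - w0) + ((w' - w0) + (w0 + w0)) by ring.
  rewrite (le_trans (normcD _ _)) // (le_trans (lerD wd (normcD _ _))) //.
  rewrite (le_trans (lerD (lexx d) (lerD wd' (normcD _ _)))) //.
  by rewrite -/A; lra.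
have wA : normc w <= A + 1.
  have -> : w = w0 + (w - w0) by ring.
  by rewrite (le_trans (normcD _ _)) // lerD2l (le_trans wd).
(* Three errors: the radial factor is taken at w' instead of w0, the radial power is linearized, and
   the differential of |w|^2 is taken at w0. *)
have -> : kernel w - kernel w' - dkernel w0 h =
    h^* * (g (sqnorm w') - g (sqnorm w0))%:C
    + (w^* * (g (sqnorm w) - g (sqnorm w') - g1 * (sqnorm w - sqnorm w'))%:C
    + g1%:C * (w^* * (sqnorm w - sqnorm w')%:C - w0^* * (2 * dotc w0 h)%:C)).
  by rewrite /kernel /dkernel /h -/g1 -/(g _) -/(g _) -/(g _); ring.
have B1 : normc (h^* * (g (sqnorm w') - g (sqnorm w0))%:C) <=
    (`|g1| + 1) * (2 * A + 1) * d * normc h.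
  rewrite normcM normc_conj normc_real mulrC ler_wpM2r //.
  rewrite -mulrA -[X in `|X|](subrK (g1 * (sqnorm w' - sqnorm w0))).
  rewrite (le_trans (ler_normD _ _)) // mulrDl [leRHS]addrC; apply: lerD.
    rewrite (le_trans (hd _ _ nwd' n0d)) // ler_pM // ?(ltW e'0) //.
    by rewrite (le_trans nw') // ler_wpM2l.
  by rewrite normrM ler_wpM2l // (le_trans nw') // ler_wpM2l.
have B2 : normc (w^* * (g (sqnorm w) - g (sqnorm w') - g1 * (sqnorm w
  - sqnorm w'))%:C)
    <= M1 * e' * normc h.
  rewrite normcM normc_conj normc_real.
  have -> : M1 * e' * normc h = (A + 1) * (e' * ((2 * A + 2) * normc h))
    by rewrite /M1; ring.
  rewrite ler_pM ?normc_ge0 // (le_trans (hd _ _ nwd nwd')) // ler_wpM2l //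
    ltW //.
have B3 : normc (g1%:C * (w^* * (sqnorm w - sqnorm w')%:C
  - w0^* * (2 * dotc w0 h)%:C))
    <= `|g1| * (4 * A + 2) * d * normc h.
  rewrite normcM normc_real -!mulrA ler_wpM2l //.
  have -> : w^* * (sqnorm w - sqnorm w')%:C - w0^* * (2 * dotc w0 h)%:C =
      (w - w0)^* * (sqnorm w - sqnorm w')%:C
      + w0^* * (dotc ((w - w0) + (w' - w0)) h)%:C.
    rewrite sqnormB -/h.
    have -> : dotc (w + w') h = dotc (w - w0 + (w' - w0)) h + 2 * dotc w0 h.
      have {1}-> : w + w' = (w - w0 + (w' - w0)) + (w0 + w0) by ring.
      by rewrite dotcDl (dotcDl w0); ring.
    by ring.
  have -> : (4 * A + 2) * (d * normc h) = d * ((2 * A + 2) * normc h) +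
    A * ((d + d) * normc h) by ring.
  rewrite (le_trans (normcD _ _)) // !normcM !normc_conj !normc_real lerD //.
    by rewrite ler_pM ?normc_ge0.
  rewrite ler_wpM2l ?normc_ge0 // (le_trans (dotc_le _ _)) // ler_wpM2r //.
  by rewrite (le_trans (normcD _ _)) // lerD.
rewrite (le_trans (normcD _ _)) // (le_trans (lerD B1 (normcD _ _))) //.
rewrite (le_trans (lerD (lexx _) (lerD B2 B3))) //.
have -> : (`|g1| + 1) * (2 * A + 1) * d * normc h
   + (M1 * e' * normc h + `|g1| * (4 * A + 2) * d * normc h)
   = (M2 * d + M1 * e') * normc h by rewrite /M2; ring.
by rewrite ler_wpM2r //; lra.
Qed.

End Kernel.

(** * Linearization at a self-similar configuration *)

Section ClusterLinearization.
Variables (R : realType) (alpha c a b : R) (x0 x1 x2 : R) (a0 a1 a2 : R[i]).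
Implicit Types (u v w h q : R[i]).

Local Notation f := (kernel alpha).
Local Notation df := (dkernel alpha).
Local Notation ic := ('i * c%:C : R[i]).

(** Conjugate velocities within a cluster of three. Oddness of the kernel is built in, so that only
    three differences occur and pair identities close by [ring]. *)
Definition field0 u0 u1 u2 : R[i] := ic * (x1%:C * f (u0 - u1) +
  x2%:C * f (u0 - u2)).
Definition field1 u0 u1 u2 : R[i] := ic * (- (x0%:C * f (u0 - u1)) +
  x2%:C * f (u1 - u2)).
Definition field2 u0 u1 u2 : R[i] := ic * (- (x0%:C * f (u0 - u2))
  - x1%:C * f (u1 - u2)).

Definition dfield0 v0 v1 v2 : R[i] :=
  ic * (x1%:C * df (a0 - a1) (v0 - v1) + x2%:C * df (a0 - a2) (v0 - v2)).
Definition dfield1 v0 v1 v2 : R[i] :=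
  ic * (- (x0%:C * df (a0 - a1) (v0 - v1)) + x2%:C * df (a1 - a2) (v1 - v2)).
Definition dfield2 v0 v1 v2 : R[i] :=
  ic * (- (x0%:C * df (a0 - a2) (v0 - v2)) - x1%:C * df (a1 - a2) (v1 - v2)).

Lemma field_sum u0 u1 u2 :
  x0%:C * field0 u0 u1 u2 + x1%:C * field1 u0 u1 u2 +
    x2%:C * field2 u0 u1 u2 = 0.
Proof. rewrite /field0 /field1 /field2; ring. Qed.

Hypothesis a_gt0 : 0 < a.
Hypothesis a01 : a0 != a1.
Hypothesis a02 : a0 != a2.
Hypothesis a12 : a1 != a2.
Let l : R[i] := a -i* b.
Hypothesis F0 : field0 a0 a1 a2 = a0^* * l.
Hypothesis F1 : field1 a0 a1 a2 = a1^* * l.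
Hypothesis F2 : field2 a0 a1 a2 = a2^* * l.

Let l_neq0 : l != 0.
Proof. by rewrite /l eq_complex /= negb_and (gt_eqF a_gt0). Qed.

(** The internal field has zero weighted sum, and on this configuration that sum is [l] times the
    conjugate of the weighted center, with [l] nonzero because a > 0. *)
Lemma center_eq0 : x0%:C * a0 + x1%:C * a1 + x2%:C * a2 = 0.
Proof.
have := field_sum a0 a1 a2; rewrite F0 F1 F2 => h.
have {}h : (x0%:C * a0^* + x1%:C * a1^* + x2%:C * a2^*) * l = 0 by rewrite -h;
  ring.
move/eqP : h; rewrite mulf_eq0 (negbTE l_neq0) orbF => /eqP h.
apply: (inv_inj (@conjCK _)); rewrite rmorph0 -h !rmorphD !rmorphM /=.
by rewrite !conj_real.
Qed.

Lemma Re_icM w : complex.Re (ic * w) = - c * complex.Im w.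
Proof. by case: w => x y /=; ring. Qed.

Lemma Im_icM w : complex.Im (ic * w) = c * complex.Re w.
Proof. by case: w => x y /=; ring. Qed.

Lemma ReD u w : complex.Re (u + w) = complex.Re u + complex.Re w.
Proof. by case: u w => ? ? [? ?]. Qed.
Lemma ImD u w : complex.Im (u + w) = complex.Im u + complex.Im w.
Proof. by case: u w => ? ? [? ?]. Qed.
Lemma ReN u : complex.Re (- u) = - complex.Re u.
Proof. by case: u. Qed.
Lemma ImN u : complex.Im (- u) = - complex.Im u.
Proof. by case: u. Qed.
Lemma ReCM (r : R) u : complex.Re (r%:C * u) = r * complex.Re u.
Proof. by case: u => ? ? /=; ring. Qed.
Lemma ImCM (r : R) u : complex.Im (r%:C * u) = r * complex.Im u.
Proof. by case: u => ? ? /=; ring. Qed.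
Lemma Re_conj u : complex.Re u^* = complex.Re u.
Proof. by case: u. Qed.
Lemma Im_conj u : complex.Im u^* = - complex.Im u.
Proof. by case: u. Qed.

(** Conservation of angular impulse under expansion. The sum of x_j a_j field_j is i times a real
    number because forces are central, while by self-similarity its real part is [a] times the
    left-hand side. *)
Lemma inertia_eq0 :
  x0 * sqnorm a0 + x1 * sqnorm a1 + x2 * sqnorm a2 = 0.
Proof.
have Im_f w : complex.Im (w * f w) = 0.
  by rewrite /kernel; case: w => [u v] /=; ring.
have : complex.Re (x0%:C * (a0 * field0 a0 a1 a2) +
  x1%:C * (a1 * field1 a0 a1 a2)
    + x2%:C * (a2 * field2 a0 a1 a2)) = 0.
  have -> : x0%:C * (a0 * field0 a0 a1 a2) + x1%:C * (a1 * field1 a0 a1 a2)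
    + x2%:C * (a2 * field2 a0 a1 a2) =
    ic * ((x0 * x1)%:C * ((a0 - a1) * f (a0 - a1)) +
      (x0 * x2)%:C * ((a0 - a2) * f (a0 - a2))
      + (x1 * x2)%:C * ((a1 - a2) * f (a1 - a2))).
    by rewrite /field0 /field1 /field2; ring.
  by rewrite Re_icM !ImD !ImCM !Im_f; ring.
rewrite F0 F1 F2 !ReD !ReCM => h.
have {}h : a * (x0 * sqnorm a0 + x1 * sqnorm a1 + x2 * sqnorm a2) = 0.
  rewrite -h /sqnorm; case: a0 a1 a2 => [? ?] [? ?] [? ?] /=; ring.
by move/eqP : h; rewrite mulf_eq0 (gt_eqF a_gt0) /= => /eqP.
Qed.

Definition moment v0 v1 v2 : R[i] :=
  x0%:C * (a0^* * v0) + x1%:C * (a1^* * v1) + x2%:C * (a2^* * v2).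

(** The linearized log-time equation in the expanding frame, up to the factor 1/kappa. The field
    gives conjugate velocities, hence the conjugate; the subtracted term comes from the motion of
    the frame. *)
Definition lin0 v0 v1 v2 : R[i] := (dfield0 v0 v1 v2)^* - l^* * v0.
Definition lin1 v0 v1 v2 : R[i] := (dfield1 v0 v1 v2)^* - l^* * v1.
Definition lin2 v0 v1 v2 : R[i] := (dfield2 v0 v1 v2)^* - l^* * v2.

Lemma momentB u0 u1 u2 v0 v1 v2 :
  moment (u0 - v0) (u1 - v1) (u2 - v2) = moment u0 u1 u2 - moment v0 v1 v2.
Proof. rewrite /moment; ring. Qed.

Lemma moment_comb w u0 u1 u2 v0 v1 v2 :
  moment (w * u0 + v0) (w * u1 + v1) (w * u2 + v2) = w * moment u0 u1 u2 +
    moment v0 v1 v2.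
Proof. rewrite /moment; ring. Qed.

(* Angular impulse: [Re (moment v)] is the differential at [a] of a first
   integral of degree 2, half of [sum_j x_j |z_j|^2]. *)
Lemma moment_lin_Re v0 v1 v2 :
  complex.Re (moment (lin0 v0 v1 v2) (lin1 v0 v1 v2) (lin2 v0 v1 v2)) =
  - 2 * a * complex.Re (moment v0 v1 v2).
Proof.
rewrite momentB ReD ReN.
have -> : moment (l^* * v0) (l^* * v1) (l^* * v2) = l^* * moment v0 v1 v2.
  by rewrite /moment; ring.
(* Together with the frame term this gives - Re (l M) - Re (l^* M) = - 2 a Re M, where M is the
   moment of v. *)
have -> : complex.Re (moment (dfield0 v0 v1 v2)^* (dfield1 v0 v1 v2)^* (dfield2
  v0 v1 v2)^*)
   = - complex.Re (l * moment v0 v1 v2).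
  have -> : l * moment v0 v1 v2 = x0%:C * (v0 * field0 a0 a1 a2)
     + x1%:C * (v1 * field1 a0 a1 a2) + x2%:C * (v2 * field2 a0 a1 a2).
    by rewrite F0 F1 F2 /moment; ring.
  have -> : x0%:C * (v0 * field0 a0 a1 a2)
     + x1%:C * (v1 * field1 a0 a1 a2) + x2%:C * (v2 * field2 a0 a1 a2) =
    ic * ((x0 * x1)%:C * ((v0 - v1) * f (a0 - a1)) +
      (x0 * x2)%:C * ((v0 - v2) * f (a0 - a2))
      + (x1 * x2)%:C * ((v1 - v2) * f (a1 - a2))).
    by rewrite /field0 /field1 /field2; ring.
  rewrite -Re_conj.
  have -> : (moment (dfield0 v0 v1 v2)^* (dfield1 v0 v1 v2)^* (dfield2 v0 v1
    v2)^*)^* =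
    ic * ((x0 * x1)%:C * ((a0 - a1) * df (a0 - a1) (v0 - v1))
      + (x0 * x2)%:C * ((a0 - a2) * df (a0 - a2) (v0 - v2))
      + (x1 * x2)%:C * ((a1 - a2) * df (a1 - a2) (v1 - v2))).
    rewrite /moment !rmorphD !rmorphM /= !conj_real !conjCK.
    by rewrite /dfield0 /dfield1 /dfield2; ring.
  by rewrite !Re_icM !ImD !ImCM !dkernel_momentum; ring.
by rewrite /l; case: (moment v0 v1 v2) => x y /=; ring.
Qed.

(* [Im (l * moment v)] is the differential at [a] of the Hamiltonian, which is
   homogeneous of degree [alpha - 2]. *)
Lemma moment_lin_Im v0 v1 v2 :
  complex.Im (l * moment (lin0 v0 v1 v2) (lin1 v0 v1 v2) (lin2 v0 v1 v2)) =
  (2 - alpha) * a * complex.Im (l * moment v0 v1 v2).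
Proof.
have w01 : a0 - a1 != 0 by rewrite subr_eq0.
have w02 : a0 - a2 != 0 by rewrite subr_eq0.
have w12 : a1 - a2 != 0 by rewrite subr_eq0.
pose M := l * moment v0 v1 v2.
have ME : M = ic * ((x0 * x1)%:C * ((v0 - v1) * f (a0 - a1)) +
  (x0 * x2)%:C * ((v0 - v2) * f (a0 - a2))
      + (x1 * x2)%:C * ((v1 - v2) * f (a1 - a2))).
  have -> : M = x0%:C * (v0 * field0 a0 a1 a2)
     + x1%:C * (v1 * field1 a0 a1 a2) + x2%:C * (v2 * field2 a0 a1 a2).
    by rewrite F0 F1 F2 /M /moment; ring.
  by rewrite /field0 /field1 /field2; ring.
rewrite momentB.
have -> : moment (l^* * v0) (l^* * v1) (l^* * v2) = l^* * moment v0 v1 v2.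
  by rewrite /moment; ring.
rewrite mulrBr ImD ImN mulrCA -/M.
(* Symmetry of [dkernel] moves the factors l^* (a_j - a_k) into the direction slot, where
   homogeneity with q = l^* applies: Re q = a and Im q = b. *)
have -> : complex.Im (l * moment (dfield0 v0 v1 v2)^* (dfield1 v0 v1 v2)^*
  (dfield2 v0 v1 v2)^*)
   = - complex.Im ((((alpha - 3) * a)%:C - 'i * b%:C) * M).
  rewrite -[LHS]opprK -Im_conj; congr (- _).
  have -> : (l * moment (dfield0 v0 v1 v2)^* (dfield1 v0 v1 v2)^* (dfield2 v0 v1
    v2)^*)^* =
    ic * ((x0 * x1)%:C * ((l^* * (a0 - a1)) * df (a0 - a1) (v0 - v1))
      + (x0 * x2)%:C * ((l^* * (a0 - a2)) * df (a0 - a2) (v0 - v2))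
      + (x1 * x2)%:C * ((l^* * (a1 - a2)) * df (a1 - a2) (v1 - v2))).
    rewrite /moment rmorphM !rmorphD !rmorphM /= !conj_real !conjCK.
    by rewrite /dfield0 /dfield1 /dfield2; ring.
  rewrite Im_icM !ReD !ReCM.
  rewrite dkernel_sym (dkernel_sym _ (a0 - a2)) (dkernel_sym _ (a1 - a2)).
  rewrite !dkernel_homogeneous //.
  rewrite ME [RHS](_ : _ = complex.Im (ic * ((x0 * x1)%:C * ((v0
    - v1) * ((((alpha - 3) * a)%:C - 'i * b%:C) * f (a0 - a1)))
     + (x0 * x2)%:C * ((v0 - v2) * ((((alpha - 3) * a)%:C - 'i * b%:C) * f (a0
       - a2)))
      + (x1 * x2)%:C * ((v1 - v2) * ((((alpha - 3) * a)%:C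
        - 'i * b%:C) * f (a1 - a2)))))); last first.
    by congr (complex.Im _); ring.
  by rewrite Im_icM !ReD !ReCM Re_conj Im_conj /= opprK.
by move: M {ME} => [x y]; rewrite /l /=; ring.
Qed.

Lemma dfield0_homogeneous q : dfield0 (q * a0) (q * a1) (q * a2) =
  (((alpha - 3) * complex.Re q)%:C - 'i * (complex.Im q)%:C) * (a0^* * l).
Proof.
rewrite /dfield0 -!mulrBr !dkernel_homogeneous ?subr_eq0 // -F0 /field0; ring.
Qed.

(** Rotations (imaginary q) are annihilated. As kappa = (4 - alpha) a, after division by kappa a
    real part r of q contributes - r (1 + i b/a): the exponent -1 on Re q, and a coupling - b/a from
    Re q to Im q. *)
Lemma lin0_homogeneous q : lin0 (q * a0) (q * a1) (q * a2) =
  ((alpha - 4) * complex.Re q)%:C * l^* * a0.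
Proof.
rewrite /lin0 dfield0_homogeneous.
by case: q a0 => [u v] [x y]; rewrite /l; apply/eqP; rewrite eq_complex /=;
  apply/andP; split; apply/eqP; ring.
Qed.

Lemma dfield0D u0 u1 u2 v0 v1 v2 :
  dfield0 (u0 + v0) (u1 + v1) (u2 + v2) = dfield0 u0 u1 u2 + dfield0 v0 v1 v2.
Proof.
rewrite /dfield0 (_ : u0 + v0 - (u1 + v1) = (u0 - u1) + (v0 - v1));
  last by ring.
rewrite (_ : u0 + v0 - (u2 + v2) = (u0 - u2) + (v0 - v2)); last by ring.
by rewrite !dkernelD; ring.
Qed.

Lemma dfield0Z (r : R) v0 v1 v2 :
  dfield0 (r%:C * v0) (r%:C * v1) (r%:C * v2) = r%:C * dfield0 v0 v1 v2.
Proof. by rewrite /dfield0 -!mulrBr !dkernelZ; ring. Qed.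

End ClusterLinearization.

(** * Perturbations near the initial time *)

Section ComplexCurves.
Variable R : realType.
Implicit Types (f g : R -> R[i]) (t : R) (v w : R[i]).

(** Coordinatewise, like [cderiv] below, so that real calculus applies; the complex topology enters
    through [cderiv_time_derive] and [normc_cvg]. *)
Definition ccont f t : Prop :=
  {for t, continuous (fun u => complex.Re (f u))} /\
  {for t, continuous (fun u => complex.Im (f u))}.

Lemma ccont_cst w t : ccont (fun=> w) t.
Proof. by split; exact: cvg_cst. Qed.

Lemma ccont_real (r : R -> R) t : {for t, continuous r}
  -> ccont (fun u => (r u)%:C) t.
Proof. by move=> cr; split => //; exact: cvg_cst. Qed.

Lemma ccont_ext f g t : (forall u, f u = g u) -> ccont f t -> ccont g t.
Proof. by move=> /funext ->. Qed.

Lemma ccontD f g t : ccont f t -> ccont g t -> ccont (fun u => f u + g u) t.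
Proof.
move=> [f1 f2] [g1 g2]; split.
  rewrite (_ : (fun u => _) = (fun u => complex.Re (f u) + complex.Re (g u))).
    exact: cvgD.
  by apply/funext => u; rewrite ReD.
rewrite (_ : (fun u => _) = (fun u => complex.Im (f u) + complex.Im (g u))).
  exact: cvgD.
by apply/funext => u; rewrite ImD.
Qed.

Lemma ccontM f g t : ccont f t -> ccont g t -> ccont (fun u => f u * g u) t.
Proof.
move=> [f1 f2] [g1 g2]; split.
  rewrite (_ : (fun u => _) = (fun u => complex.Re (f u) * complex.Re (g u)
    - complex.Im (f u) * complex.Im (g u))).
    by apply: cvgB; exact: cvgM.
  by apply/funext => u; case: (f u) (g u) => [? ?] [? ?].
rewrite (_ : (fun u => _) = (fun u => complex.Re (f u) * complex.Im (g u)
    + complex.Im (f u) * complex.Re (g u))).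
  by apply: cvgD; exact: cvgM.
by apply/funext => u; case: (f u) (g u) => [? ?] [? ?].
Qed.

Lemma ccont_conj f t : ccont f t -> ccont (fun u => (f u)^*) t.
Proof.
move=> [f1 f2]; split.
  rewrite (_ : (fun u => _) = (fun u => complex.Re (f u))) //.
  by apply/funext => u; rewrite Re_conj.
rewrite (_ : (fun u => _) = (fun u => - complex.Im (f u))); first exact: cvgN.
by apply/funext => u; rewrite Im_conj.
Qed.

Lemma ccont_kernel alpha f t : f t != 0 -> ccont f t ->
  ccont (fun u => kernel alpha (f u)) t.
Proof.
move=> ft0 cf; apply: ccontM; first exact: ccont_conj.
apply: ccont_real; have [c1 c2] := cf.
apply: (@continuous_comp _ _ _ (fun u => sqnorm (f u)) (@powR R ^~ _)).
  by apply: cvgD; apply: cvgM.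
exact: continuous_powR (sqnorm_gt0 ft0).
Qed.

Definition cderiv f t v : Prop :=
  is_derive t 1 (fun u => complex.Re (f u)) (complex.Re v) /\
  is_derive t 1 (fun u => complex.Im (f u)) (complex.Im v).

Lemma ReM z w : complex.Re (z * w) =
  complex.Re z * complex.Re w - complex.Im z * complex.Im w.
Proof. by case: z w => ? ? [? ?]. Qed.

Lemma ImM z w : complex.Im (z * w) =
  complex.Re z * complex.Im w + complex.Im z * complex.Re w.
Proof. by case: z w => ? ? [? ?]. Qed.

Lemma cderiv_ext f g t v w : (forall u, f u = g u) -> v = w ->
  cderiv f t v -> cderiv g t w.
Proof. by move=> /funext -> ->. Qed.

Lemma cderiv_cst w t : cderiv (fun=> w) t 0.
Proof. by split; exact: is_derive_cst. Qed.

Lemma cderivD f g t v w : cderiv f t v -> cderiv g t w ->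
  cderiv (fun u => f u + g u) t (v + w).
Proof.
move=> [f1 f2] [g1 g2]; split.
  by apply: is_derive_ext (is_deriveD f1 g1) => [u|]; rewrite /= ?ReD.
by apply: is_derive_ext (is_deriveD f2 g2) => [u|]; rewrite /= ?ImD.
Qed.

Lemma cderivM f g t v w : cderiv f t v -> cderiv g t w ->
  cderiv (fun u => f u * g u) t (v * g t + f t * w).
Proof.
move=> [f1 f2] [g1 g2]; split.
  apply: is_derive_ext (is_deriveB (is_deriveM f1 g1) (is_deriveM f2 g2)).
    by move=> u; rewrite ReM.
  case: (f t) (g t) v w {f1 f2 g1 g2} => [? ?] [? ?] [? ?] [? ?].
  by rewrite /= /GRing.scale /=; ring.
apply: is_derive_ext (is_deriveD (is_deriveM f1 g2) (is_deriveM f2 g1)).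
  by move=> u; rewrite ImM.
case: (f t) (g t) v w {f1 f2 g1 g2} => [? ?] [? ?] [? ?] [? ?].
by rewrite /= /GRing.scale /=; ring.
Qed.

Lemma cderivZ w f t v : cderiv f t v -> cderiv (fun u => w * f u) t (w * v).
Proof.
by move=> fv; apply: cderiv_ext (cderivM (cderiv_cst w t) fv) => //;
  rewrite mul0r add0r.
Qed.

Lemma cderiv_conj f t v : cderiv f t v -> cderiv (fun u => (f u)^*) t v^*.
Proof.
move=> [f1 f2]; split.
  by apply: is_derive_ext f1 => [u|]; rewrite Re_conj.
by apply: is_derive_ext (is_deriveN f2) => [u|]; rewrite /= ?Im_conj.
Qed.

Lemma cderiv_time_derive f t v : cderiv f t v -> is_time_derive f t v.
Proof.
move=> [[d1 e1] [d2 e2]].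
have h1 : h^-1 *: (complex.Re (f (h *: 1 + t))
  - complex.Re (f t)) @[h --> 0^'] --> complex.Re v.
  by rewrite -e1; exact: d1.
have h2 : h^-1 *: (complex.Im (f (h *: 1 + t))
  - complex.Im (f t)) @[h --> 0^'] --> complex.Im v.
  by rewrite -e2; exact: d2.
apply/cvgrPdist_lt => e e0.
(* In the order of R[i], 0 < e forces [e] to be real. *)
have eR : e = (complex.Re e)%:C by rewrite RRe_real // gtr0_real.
have e0' : 0 < complex.Re e / 2 by rewrite divr_gt0 //; move: e0;
  rewrite eR ltcR.
move/cvgrPdist_lt : h1 => /(_ _ e0') h1; move/cvgrPdist_lt : h2 => /(_ _ e0')
  h2.
near=> h.
rewrite normcE eR ltcR (le_lt_trans (normc_le _)) // [ltRHS]splitr.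
rewrite !(ReD, ImD, ReN, ImN, ReCM, ImCM).
have E : t + h = h *: 1 + t by rewrite /GRing.scale /= mulr1 addrC.
by rewrite E ltrD //; near: h.
Unshelve. all: by end_near.
Qed.

End ComplexCurves.

Section SmallTime.
Variable R : realType.
Implicit Types (p e t T : R).

Lemma near0_gt0 : \forall t \near 0^'+, (0 : R) < t.
Proof. exact: nbhs_right_gt. Qed.

Lemma powR_small p e : 0 < p -> 0 < e -> \forall t \near 0^'+, t `^ p <= e.
Proof.
move=> p0 e0; near=> t.
have t0 : 0 < t by near: t; exact: near0_gt0.
have te : t <= e `^ p^-1 by near: t; apply: nbhs_right_le; exact: powR_gt0.
rewrite -(powRVr e0 (lt0r_neq0 p0)); apply: ge0_ler_powR => //.
- exact: ltW.
- by rewrite nnegrE ltW.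
- by rewrite nnegrE powR_ge0.
Unshelve. all: by end_near.
Qed.

Lemma near0_interval (P : R -> Prop) : (\forall t \near 0^'+, P t) ->
  exists2 T, 0 < T & forall t, 0 < t < T -> P t.
Proof.
move=> [T /= T0 h]; exists T => // t /andP[t0 tT]; apply: h => //=.
by rewrite sub0r normrN gtr0_norm.
Qed.

End SmallTime.

(** * Calculus of functions of time and state, at the scale t^mu *)

Section StateFunctions.
Variables (R : realType) (J : Type) (mu : R).
Hypothesis mu_gt0 : 0 < mu.
Implicit Types (W : R -> (J -> R) -> R[i]) (w : R[i]) (t e L D : R) (m : J
  -> R).

Definition ubox t m := forall j, `|m j| <= t `^ mu.

(** Continuity is asked only along continuous curves of states, the form in which the fixed-point
    theorem uses it. *)
Definition tracks W := \forall t \near 0^'+, forall m : R -> J -> R,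
  ubox t (m t) -> (forall j, {for t, continuous (m^~ j)}) ->
  ccont (fun u => W u (m u)) t.

Definition tends w W := forall e, 0 < e -> \forall t \near 0^'+, forall m,
  ubox t m -> normc (W t m - w) <= e.

Definition lips L W := \forall t \near 0^'+, forall m m' D, 0 <= D ->
  ubox t m -> ubox t m' -> (forall j, `|m j - m' j| <= D * t `^ mu) ->
  normc (W t m - W t m') <= L * (D * t `^ mu).

(* [m] ranges over states of size [O(t^mu)], on which [W] tends to [w]. *)
Definition regular w W := [/\ tracks W, tends w W & exists2 L,
  0 <= L & lips L W].

(* [W] is [o(t^mu)] and [o(1)]-Lipschitz: a perturbation that does not affect
   the leading order of the dynamics. *)
Definition small W := [/\ tracks W,
  forall e, 0 < e -> \forall t \near 0^'+, normc (W t (fun=> 0)) <= e * t `^ mu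
    &
  forall e, 0 < e -> lips e W].

Lemma ubox0 t : ubox t (fun=> 0).
Proof. by move=> j; rewrite normr0 powR_ge0. Qed.

Lemma tends_bound w W : tends w W -> \forall t \near 0^'+, forall m, ubox t m ->
  normc (W t m) <= normc w + 1.
Proof.
move=> /(_ 1 ltr01); apply: filterS => t h m /h {}h.
by rewrite -[W t m](subrK w) addrC (le_trans (normcD _ _)) // lerD2l.
Qed.

Lemma regular_cst w : regular w (fun _ _ => w).
Proof.
split; first by apply: nearW => t m _ _; exact: ccont_cst.
  by move=> e e0; apply: nearW => t m _; rewrite subrr normc0 ltW.
exists 0 => //; apply: nearW => t m m' D _ _ _ _.
by rewrite subrr normc0 mul0r.
Qed.

Lemma regular_coord j : regular 0 (fun _ m => (m j)%:C).
Proof.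
split; first by apply: nearW => t m _ cm; apply: ccont_real; exact: cm.
  move=> e e0; apply: filterS (powR_small mu_gt0 e0) => t te m bm.
  by rewrite subr0 normc_real (le_trans (bm j)).
exists 1 => //; apply: nearW => t m m' D _ _ _ /(_ j).
by rewrite mul1r -rmorphB normc_real.
Qed.

Lemma regular_time (r : R -> R[i]) : (\forall t \near 0^'+, ccont r t) ->
  (forall e, 0 < e -> \forall t \near 0^'+, normc (r t) <= e) ->
  regular 0 (fun t _ => r t).
Proof.
move=> cr hr; split; first by apply: filterS cr => t ct m _ _.
  by move=> e /hr; apply: filterS => t rt m _; rewrite subr0.
exists 0 => //; apply: nearW => t m m' D _ _ _ _.
by rewrite subrr normc0 mul0r.
Qed.

Lemma regularD w1 w2 W1 W2 : regular w1 W1 -> regular w2 W2 ->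
  regular (w1 + w2) (fun t m => W1 t m + W2 t m).
Proof.
move=> [c1 t1 [L1 L10 l1]] [c2 t2 [L2 L20 l2]]; split.
- by apply: filterS2 c1 c2 => t h1 h2 m bm cm; apply: ccontD;
  [exact: h1|exact: h2].
- move=> e e0; have e20 : 0 < e / 2 by rewrite divr_gt0.
  apply: filterS2 (t1 _ e20) (t2 _ e20) => t h1 h2 m bm.
  rewrite [e]splitr opprD addrACA (le_trans (normcD _ _)) // lerD //.
    exact: h1.
  exact: h2.
- exists (L1 + L2); first exact: addr_ge0.
  apply: filterS2 l1 l2 => t h1 h2 m m' D D0 bm bm' dm.
  rewrite opprD addrACA mulrDl (le_trans (normcD _ _)) // lerD //.
    exact: h1.
  exact: h2.
Qed.

Lemma regularM w1 w2 W1 W2 : regular w1 W1 -> regular w2 W2 ->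
  regular (w1 * w2) (fun t m => W1 t m * W2 t m).
Proof.
move=> [c1 t1 [L1 L10 l1]] [c2 t2 [L2 L20 l2]].
have b1 := tends_bound t1; have b2 := tends_bound t2.
have n1 := normc_ge0 w1; have n2 := normc_ge0 w2.
split.
- by apply: filterS2 c1 c2 => t h1 h2 m bm cm; apply: ccontM;
  [exact: h1|exact: h2].
- move=> e e0; pose M := normc w1 + normc w2 + 1.
  have M0 : 0 < M by rewrite /M; lra.
  have e'0 : 0 < e / M by rewrite divr_gt0.
  apply: filterS3 (t1 _ e'0) (t2 _ e'0) b2 => t h1 h2 h3 m bm.
  have -> : W1 t m * W2 t m - w1 * w2 = (W1 t m - w1) * W2 t m +
    w1 * (W2 t m - w2) by ring.
  rewrite (le_trans (normcD _ _)) // !normcM.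
  have -> : e = e / M * (normc w2 + 1) + normc w1 * (e / M).
    by rewrite /M; field; rewrite gt_eqF //; lra.
  by rewrite lerD // ler_pM ?normc_ge0 // ?h1 ?h2 ?h3.
- exists (L1 * (normc w2 + 1) + (normc w1 + 1) * L2).
    by rewrite addr_ge0 // mulr_ge0 //; lra.
  near=> t; move=> m m' D D0 bm bm' dm.
  have -> : W1 t m * W2 t m - W1 t m' * W2 t m' =
    (W1 t m - W1 t m') * W2 t m + W1 t m' * (W2 t m - W2 t m') by ring.
  have -> : (L1 * (normc w2 + 1) + (normc w1 + 1) * L2) * (D * t `^ mu) =
    (L1 * (D * t `^ mu)) * (normc w2 + 1) + (normc w1 +
      1) * (L2 * (D * t `^ mu)).
    by ring.
  rewrite (le_trans (normcD _ _)) // !normcM lerD //.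
    rewrite ler_pM ?normc_ge0 //; first by move: m m' D D0 bm bm' dm; near: t.
    by move: m bm {dm}; near: t.
  rewrite ler_pM ?normc_ge0 //; first by move: m' bm' {dm}; near: t.
  by move: m m' D D0 bm bm' dm; near: t.
Unshelve. all: by end_near.
Qed.

Lemma regularZ w w' W : regular w W -> regular (w' * w) (fun t m => w' * W t m).
Proof. by move=> h; apply: regularM => //; exact: regular_cst. Qed.

Lemma regularN w W : regular w W -> regular (- w) (fun t m => - W t m).
Proof.
move=> h; have := regularZ (-1) h; rewrite mulN1r.
by rewrite (_ : (fun t m => -1 * W t m) = (fun t m => - W t m)) //;
  do 2!apply/funext => ?; rewrite mulN1r.
Qed.

Lemma regularB w1 w2 W1 W2 : regular w1 W1 -> regular w2 W2 ->
  regular (w1 - w2) (fun t m => W1 t m - W2 t m).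
Proof. by move=> h1 h2; apply: regularD => //; exact: regularN. Qed.

Lemma regular_conj w W : regular w W -> regular w^* (fun t m => (W t m)^*).
Proof.
move=> [c1 t1 [L1 L10 l1]]; split.
- by apply: filterS c1 => t h m bm cm; apply: ccont_conj; exact: h.
- move=> e /t1; apply: filterS => t h m bm.
  by rewrite -rmorphB normc_conj h.
- exists L1 => //; apply: filterS l1 => t h m m' D D0 bm bm' dm.
  by rewrite -rmorphB normc_conj h.
Qed.

Lemma regular_sum (I : Type) (r : seq I) (P : pred I) (w : I -> R[i])
    (W : I -> R -> (J -> R) -> R[i]) :
  (forall i, P i -> regular (w i) (W i)) ->
  regular (\sum_(i <- r | P i) w i) (fun t m => \sum_(i <- r | P i) W i t m).
Proof.
move=> h; elim: r => [|i r IH].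
  rewrite big_nil (_ : (fun t m => _) = (fun _ _ => 0));
    first exact: regular_cst.
  by do 2!apply/funext => ?; rewrite big_nil.
rewrite big_cons.
rewrite (_ : (fun t m => _) = (fun t m => if P i then W i t m +
  \sum_(i <- r | P i) W i t m
   else \sum_(i <- r | P i) W i t m)); last by do 2!apply/funext => ?;
     rewrite big_cons.
by case: ifP => // Pi; apply: regularD => //; exact: h.
Qed.

(** Strict differentiability with e = 1 gives the local Lipschitz constant 1 + C, where [C] bounds
    the operator norm of the differential at [w]. *)
Lemma regular_kernel alpha w W : w != 0 -> regular w W ->
  regular (kernel alpha w) (fun t m => kernel alpha (W t m)).
Proof.
move=> w0 [c1 t1 [L1 L10 l1]].
have [d d0 hd] := kernel_strict alpha w0 ltr01.
pose C := sqnorm w `^ ((alpha - 4) / 2) + normc w ^+ 2 * 2 *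
  `|(alpha - 4) / 2 * sqnorm w `^ ((alpha - 4) / 2 - 1)|.
have C0 : 0 <= C by rewrite addr_ge0 ?powR_ge0 // !mulr_ge0 ?normc_ge0.
have wd : normc (w - w) <= d by rewrite subrr normc0 ltW.
have lip z z' : normc (z - w) <= d -> normc (z' - w) <= d ->
    normc (kernel alpha z - kernel alpha z') <= (1 + C) * normc (z - z').
  move=> hz hz'; rewrite -[kernel alpha z - _](subrK (dkernel alpha w (z
    - z'))).
  rewrite (le_trans (normcD _ _)) // mulrDl lerD ?hd //.
  exact: normc_dkernel.
split.
- have nw : 0 < normc w / 2 by rewrite divr_gt0 // normc_gt0.
  apply: filterS2 c1 (t1 _ nw) => t h1 h2 m bm cm.
  apply: ccont_kernel; last exact: h1.
  apply/eqP => W0; have := h2 _ bm; rewrite W0 sub0r normcN.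
  by have := normc_gt0 w0; lra.
- move=> e e0; have e'0 : 0 < Num.min d (e / (1 + C))
  by rewrite lt_min d0 divr_gt0 //; lra.
  apply: filterS (t1 _ e'0) => t h m /h; rewrite le_min => /andP[h1 h2].
  rewrite (le_trans (lip _ _ h1 wd)) // mulrC -ler_pdivlMr //; lra.
- exists ((1 + C) * L1); first by rewrite mulr_ge0 //; lra.
  apply: filterS2 l1 (t1 _ d0) => t h1 h2 m m' D D0 bm bm' dm.
  rewrite (le_trans (lip _ _ (h2 _ bm) (h2 _ bm'))) // -mulrA ler_wpM2l //;
    first lra.
  exact: h1.
Qed.

Lemma smallD W1 W2 : small W1 -> small W2 -> small (fun t m => W1 t m + W2 t m).
Proof.
move=> [c1 z1 l1] [c2 z2 l2]; split.
- by apply: filterS2 c1 c2 => t h1 h2 m bm cm; apply: ccontD;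
  [exact: h1|exact: h2].
- move=> e e0; have e20 : 0 < e / 2 by rewrite divr_gt0.
  apply: filterS2 (z1 _ e20) (z2 _ e20) => t h1 h2.
  by rewrite [e]splitr mulrDl (le_trans (normcD _ _)) // lerD.
- move=> e e0; have e20 : 0 < e / 2 by rewrite divr_gt0.
  apply: filterS2 (l1 _ e20) (l2 _ e20) => t h1 h2 m m' D D0 bm bm' dm.
  rewrite [e]splitr opprD addrACA mulrDl (le_trans (normcD _ _)) // lerD //.
    exact: h1.
  exact: h2.
Qed.

Lemma smallZ w W : small W -> small (fun t m => w * W t m).
Proof.
move=> [c1 z1 l1]; have n0 := normc_ge0 w.
have pos e : 0 < e -> 0 < e / (normc w + 1) by move=> e0; rewrite divr_gt0 //;
  lra.
have le_e e : 0 < e -> normc w * (e / (normc w + 1)) <= e.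
  move=> e0; rewrite mulrA ler_pdivrMr; last lra.
  by rewrite mulrDr mulr1 [e * _]mulrC lerDl ltW.
split.
- by apply: filterS c1 => t h1 m bm cm; apply: ccontM;
  [exact: ccont_cst|exact: h1].
- move=> e e0; apply: filterS (z1 _ (pos e e0)) => t h1.
  rewrite normcM (le_trans (ler_wpM2l n0 h1)) // mulrA ler_wpM2r ?powR_ge0 //.
  exact: le_e.
- move=> e e0; apply: filterS (l1 _ (pos e e0)) => t h1 m m' D D0 bm bm' dm.
  rewrite -mulrBr normcM (le_trans (ler_wpM2l n0 (h1 _ _ _ D0 bm bm' dm))) //
    [leLHS]mulrA.
  by rewrite ler_wpM2r ?mulr_ge0 ?powR_ge0 // le_e.
Qed.

Lemma smallB W1 W2 : small W1 -> small W2 -> small (fun t m => W1 t m - W2 t m).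
Proof.
move=> h1 /(smallZ (-1)) h2; have := smallD h1 h2.
by rewrite (_ : (fun t m => _ + _) = (fun t m => W1 t m - W2 t m)) //;
  do 2!apply/funext => ?; rewrite mulN1r.
Qed.

Lemma small_conj W : small W -> small (fun t m => (W t m)^*).
Proof.
move=> [c1 z1 l1]; split.
- by apply: filterS c1 => t h m bm cm; apply: ccont_conj; exact: h.
- by move=> e /z1; apply: filterS => t; rewrite normc_conj.
- move=> e /l1; apply: filterS => t h m m' D D0 bm bm' dm.
  by rewrite -rmorphB normc_conj h.
Qed.

(** The spare factor t^(p - mu) tends to 0 and absorbs both the bound and the Lipschitz constant of
    [W]. *)
Lemma small_time (p C : R) (r : R -> R[i]) w W : mu < p ->
  (\forall t \near 0^'+, ccont r t) ->
  (\forall t \near 0^'+, normc (r t) <= C * t `^ p) ->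
  regular w W -> small (fun t m => r t * W t m).
Proof.
move=> mup cr br [c1 t1 [L1 L10 l1]]; have b1 := tends_bound t1.
have n1 := normc_ge0 w.
have C0 : 0 <= C.
  have [T T0 /(_ (T / 2))] := near0_interval br.
  have T2 : 0 < T / 2 < T by apply/andP; split; lra.
  move=> /(_ T2) /(le_trans (normc_ge0 _)); rewrite pmulr_lge0 // powR_gt0 //.
  by case/andP : T2.
have small_r e : 0 < e -> \forall t \near 0^'+, normc (r t) * (normc w +
  1) <= e * t `^ mu
    /\ normc (r t) * L1 <= e.
  move=> e0; pose M := C * (normc w + 1 + L1) + 1.
  have M0 : 0 < M by rewrite /M; nra.
  have eM0 : 0 < e / M by rewrite divr_gt0.
  near=> t; have t0 : 0 < t by near: t; exact: near0_gt0.
  have rt : normc (r t) <= C * t `^ p by near: t.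
  have h1 : t `^ (p - mu) <= e / M by near: t; apply: powR_small => //;
    rewrite subr_gt0.
  have h2 : t `^ mu <= 1 by near: t; exact: powR_small.
  have pE : t `^ p = t `^ mu * t `^ (p - mu).
    by rewrite -powR_add // addrC subrK.
  have g1 := powR_ge0 t (p - mu); have g2 := powR_ge0 t mu.
  have h3 : C * (normc w + 1 + L1) * t `^ (p - mu) <= e.
    have : M * t `^ (p - mu) <= e by rewrite mulrC -ler_pdivlMr.
    by apply: le_trans; rewrite ler_wpM2r // /M lerDl.
  move: rt; rewrite pE => rt.
  set y := t `^ mu in h2 g2 rt *; set x := t `^ (p - mu) in h1 g1 rt h3 *.
  have rx : normc (r t) <= C * x.
    by rewrite (le_trans rt) // mulrCA ler_piMl // mulr_ge0.
  have hL : C * x * L1 <= e.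
    apply: le_trans h3; rewrite [leRHS](_ : _ = C * x * (normc w + 1 + L1));
      last by ring.
    by rewrite ler_wpM2l ?mulr_ge0 //; lra.
  have hw : C * x * (normc w + 1) <= e.
    apply: le_trans h3; rewrite [leRHS](_ : _ = C * x * (normc w + 1 + L1));
      last by ring.
    by rewrite ler_wpM2l ?mulr_ge0 //; lra.
  split; last by rewrite (le_trans _ hL) // ler_wpM2r.
  rewrite (le_trans (ler_wpM2r _ rt)) //; first lra.
  rewrite (_ : C * _ * _ = C * x * (normc w + 1) * y); last by ring.
  by rewrite ler_wpM2r.
split.
- by apply: filterS2 c1 cr => t h1 h2 m bm cm; apply: ccontM;
  [exact: h2|exact: h1].
- move=> e e0; apply: filterS2 (small_r _ e0) b1 => t [h1 _] h2.
  rewrite normcM (le_trans _ h1) // ler_wpM2l ?normc_ge0 //; apply: h2.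
  exact: ubox0.
- move=> e e0; apply: filterS2 (small_r _ e0) l1 => t [_ h1] h2 m m' D D0 bm bm'
  dm.
  rewrite -mulrBr normcM (le_trans (ler_wpM2l (normc_ge0 _) (h2 _ _ _ D0 bm bm'
    dm))) //.
  by rewrite [leLHS]mulrA ler_wpM2r // mulr_ge0 ?powR_ge0.
Unshelve. all: by end_near.
Qed.

Definition kernel_remainder alpha w h : R[i] :=
  kernel alpha (w + h) - kernel alpha w - dkernel alpha w h.

(** The difference of two remainders is the two-point remainder of [kernel_strict], hence the small
    Lipschitz constant. At the zero state [W] vanishes and so does the remainder. *)
Lemma small_remainder alpha w W : w != 0 -> regular 0 W ->
  (forall t, W t (fun=> 0) = 0) -> small (fun t m => kernel_remainder alpha w (W
    t m)).
Proof.
move=> w0 rW W0; have [c1 t1 [L1 L10 l1]] := rW.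
have dk0 : dkernel alpha w 0 = 0 by have := dkernelB alpha w 0 0;
  rewrite !subrr.
split.
- have rwW : regular w (fun t m => w + W t m).
    by rewrite -[w in regular w]addr0; apply: regularD => //;
      exact: regular_cst.
  have [ck _ _] := regular_kernel alpha w0 rwW.
  apply: filterS2 ck c1 => t h1 h2 m bm cm.
  have {}h1 := h1 _ bm cm; have {}h2 := h2 _ bm cm.
  have cN g : ccont g t -> ccont (fun u => - g u) t.
    move=> cg; apply: ccont_ext (ccontM (ccont_cst (-1) t) cg) => u.
    by rewrite mulN1r.
  apply: ccontD; first by apply: ccontD => //; exact: ccont_cst.
  apply: (cN (fun u => dkernel alpha w (W u (m u)))).
  apply: ccontD; first by apply: ccontM; [exact: ccont_conj|exact: ccont_cst].
  apply: ccontM; first exact: ccont_cst.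
  apply: ccont_real; apply: cvgM; first exact: cvg_cst.
  apply: cvgM; first exact: cvg_cst.
  by apply: cvgD; apply: cvgM; try exact: cvg_cst; [exact: h2.1|exact: h2.2].
- move=> e e0; apply: nearW => t; rewrite W0 /kernel_remainder addr0 subrr dk0
  subrr normc0.
  by rewrite mulr_ge0 ?powR_ge0 // ltW.
- move=> e e0; have e'0 : 0 < e / (L1 + 1) by rewrite divr_gt0 //; lra.
  have [d d0 hd] := kernel_strict alpha w0 e'0.
  apply: filterS2 l1 (t1 _ d0) => t h1 h2 m m' D D0 bm bm' dm.
  have -> : kernel_remainder alpha w (W t m) - kernel_remainder alpha w (W t m')
    =
      kernel alpha (w + W t m) - kernel alpha (w + W t m')
      - dkernel alpha w ((w + W t m) - (w + W t m')).
    rewrite (_ : w + W t m - (w + W t m') = W t m - W t m'); last by ring.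
    by rewrite dkernelB /kernel_remainder; ring.
  have cl n : ubox t n -> normc (w + W t n - w) <= d.
    by move=> /h2; rewrite subr0 [w + _]addrC addrK.
  rewrite (le_trans (hd _ _ (cl _ bm) (cl _ bm'))) //.
  rewrite (_ : w + W t m - (w + W t m') = W t m - W t m'); last by ring.
  rewrite (le_trans (ler_wpM2l (ltW e'0) (h1 _ _ _ D0 bm bm' dm))) //
    [leLHS]mulrA.
  rewrite ler_wpM2r ?mulr_ge0 ?powR_ge0 // mulrAC ler_pdivrMr; last lra.
  by rewrite ler_wpM2l ?ltW //; lra.
Qed.

End StateFunctions.

(** * Diagonal singular system with triangular coupling and small perturbation *)

Section SmallPerturbation.
Variables (R : realType) (J : finType) (mu C : R) (d : nat).
Variables (s : J -> R) (rk : J -> nat) (lin : J -> (J -> R) -> R).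
Variable S : J -> R -> (J -> R) -> R[i].
Hypothesis mu_gt0 : 0 < mu.
Hypothesis C_ge0 : 0 <= C.
Hypothesis s_lt : forall i, s i < mu.
Hypothesis rk_le : forall i, (rk i <= d)%N.
Hypothesis lin0 : forall i, lin i (fun=> 0) = 0.
Hypothesis lin_lip : forall i (m m' : J -> R) E, 0 <= E ->
  (forall j, (rk j < rk i)%N -> `|m j - m' j| <= E) ->
  `|lin i m - lin i m'| <= C * E.
Hypothesis lin_cont : forall i (m : R -> J -> R) t,
  (forall j, {for t, continuous (m^~ j)}) -> {for t,
    continuous (fun u => lin i (m u))}.
Hypothesis S_small : forall i, small mu (S i).

(* The weights [eta ^+ (d - rk j)] make the triangular coupling [lin] small. *)
Lemma small_perturbation_ode : exists2 T, 0 < T & exists m : R -> J -> R,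
  forall t, 0 < t < T -> ubox mu t (m t) /\ forall i,
    is_derive t 1 (m^~ i)
      ((s i * m t i + (lin i (m t) + complex.Re (S i t (m t)))) / t).
Proof.
(* Finiteness of [J] turns the gaps mu - s i into one uniform gap [c]. *)
have [c c0 hc] : exists2 c, 0 < c & forall i, c <= mu - s i.
  have h : \forall e \near (0 : R)^'+, forall i, e <= mu - s i.
    by apply: filter_forall => i; apply: nbhs_right_le; rewrite subr_gt0.
  have [T T0 hT] := near0_interval h.
  by exists (T / 2); [rewrite divr_gt0|apply: hT; apply/andP; split; lra].
(* A contraction by 1/2 leaves c / 2 to spend: c / 4 for [lin], which gains a factor [eta] for each
   drop of rank, and c / 4 for [S], whose constant [e] must match the smallest possible weight
   eta^d. *)
pose eta := Num.min 1 (c / (4 * (C + 1))).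
have C1 : 0 < 4 * (C + 1) by have := C_ge0; lra.
have eta0 : 0 < eta by rewrite lt_min ltr01 divr_gt0.
have [eta1 etaC] : eta <= 1 /\ C * eta <= c / 4.
  have : eta <= eta by []; rewrite {2}/eta le_min => /andP[-> h]; split => //.
  move: h C_ge0; rewrite ler_pdivlMr // => h C_ge0'; nra.
pose K j := eta ^+ (d - rk j).
have K0 j : 0 < K j by exact: exprn_gt0.
have K1 j : K j <= 1 by apply: exprn_ile1 => //; exact: ltW.
pose e := c * eta ^+ d / 4.
have e0 : 0 < e by rewrite divr_gt0 // mulr_gt0 // exprn_gt0.
have eK i : e <= c / 4 * K i.
  rewrite /e mulrAC ler_wpM2l //; first by rewrite divr_ge0 // ltW.
  rewrite /K; apply: ler_wiXn2l => //; [exact: ltW|exact: leq_subr].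
have near_all : \forall t \near 0^'+, forall i,
    [/\ forall m : R -> J -> R, ubox mu t (m t) ->
          (forall j, {for t, continuous (m^~ j)})
            -> ccont (fun u => S i u (m u)) t,
        normc (S i t (fun=> 0)) <= e * t `^ mu &
        forall m m' D, 0 <= D -> ubox mu t m -> ubox mu t m' ->
          (forall j, `|m j - m' j| <= D * t `^ mu) ->
          normc (S i t m - S i t m') <= e * (D * t `^ mu)].
  apply: filter_forall => i; have [h1 /(_ _ e0) h2 /(_ _ e0) h3] := S_small i.
  by apply: filterS3 h1 h2 h3.
have [T T0 hT] := near0_interval near_all.
have boxU t (m : J -> R) : box K mu t m -> ubox mu t m.
  by move=> bm j; rewrite (le_trans (bm j)) // ler_piMl ?powR_ge0.
pose N i t m := lin i m + complex.Re (S i t m).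
have [|||m hm] := @singular_ode R J s K mu T N T0 s_lt K0.
- move=> i t tT; rewrite /N lin0 add0r (le_trans (normc_Re _)) //.
  have [_ h _] := hT t tT i; rewrite (le_trans h) // ler_wpM2r ?powR_ge0 //.
  rewrite (le_trans (eK i)) // mulrA ler_wpM2r ?(ltW (K0 i)) //.
  by have := hc i; lra.
- move=> i t m m' D tT D0 bm bm' dm; have [_ _ h] := hT t tT i.
  have tmu : 0 <= t `^ mu by exact: powR_ge0.
  have h1 : `|lin i m - lin i m'| <= C * (eta * (D * K i * t `^ mu)).
    apply: lin_lip; first by rewrite !mulr_ge0 // ltW.
    move=> j ji; rewrite (le_trans (dm j)) //.
    have hK : K j <= eta * K i.
      rewrite /K -exprS; apply: ler_wiXn2l => //; first exact: ltW.
      by have := rk_le i; lia.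
    rewrite [leRHS](_ : _ = D * (eta * K i) * t `^ mu); last by ring.
    by rewrite ler_wpM2r // ler_wpM2l.
  have h2 : normc (S i t m - S i t m') <= e * (D * t `^ mu).
    apply: h => //; [exact: boxU|exact: boxU|].
    by move=> j; rewrite (le_trans (dm j)) // ler_wpM2r // ler_piMr.
  rewrite /N opprD addrACA (le_trans (ler_normD _ _)) //.
  rewrite -ReN -ReD (le_trans (lerD h1 (normc_Re _))) //
    (le_trans (lerD (lexx _) h2)) //.
  have k0 : 0 <= D * K i * t `^ mu by rewrite !mulr_ge0 // ltW.
  have h3 : C * (eta * (D * K i * t `^ mu)) <= c / 4 * (D * K i * t `^ mu).
    by rewrite [leLHS]mulrA ler_wpM2r.
  have h4 : e * (D * t `^ mu) <= c / 4 * (D * K i * t `^ mu).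
    rewrite [leRHS](_ : _ = c / 4 * K i * (D * t `^ mu)); last by ring.
    by rewrite ler_wpM2r // mulr_ge0.
  have h5 : c * (D * K i * t `^ mu) <= (mu - s i) * (D * K i * t `^ mu).
    by rewrite ler_wpM2r.
  rewrite (_ : (mu - s i) * _ * _ = 2^-1 * ((mu - s i) * (D * K i * t `^ mu)));
    last by ring.
  by lra.
- move=> i t m tT bm cm; have [h _ _] := hT t tT i.
  by apply: cvgD; [exact: lin_cont|exact: (h m (boxU _ _ bm) cm).1].
exists T => //; exists m => t tT; have [bm dm] := hm t tT.
by split => //; exact: boxU.
Qed.

End SmallPerturbation.

(** * The burst *)

Section SelfSimilarScale.
Variables (R : realType) (alpha a b : R).
Hypothesis alpha_lt4 : alpha < 4.
Hypothesis a_gt0 : 0 < a.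
Implicit Types t : R.

Definition growth : R := (4 - alpha) * a.
Definition scale_exp : R := (4 - alpha)^-1.

Lemma growth_gt0 : 0 < growth.
Proof. by rewrite mulr_gt0 // subr_gt0. Qed.

(** The expanding spiral that solves lam' = (a + ib) lam |lam|^(alpha - 4) for t > 0. *)
Definition scale t : R[i] :=
  ((growth * t) `^ scale_exp)%:C * (cos (b / growth * ln t) +i* sin (b / growth
    * ln t)).

Definition scale_inv t : R[i] := (scale t)^* * ((growth * t) `^ (- (2 *
  scale_exp)))%:C.

Let gt_gt0 t : 0 < t -> 0 < growth * t.
Proof. by move=> t0; rewrite mulr_gt0 // growth_gt0. Qed.

Lemma normc_scale t : normc (scale t) = (growth * t) `^ scale_exp.
Proof.
rewrite normcM normc_real ger0_norm ?powR_ge0 //.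
by rewrite [normc (_ +i* _)]/= cos2Dsin2 sqrtr1 mulr1.
Qed.

Lemma sqnorm_scale t : 0 < t -> sqnorm (scale t)
  = (growth * t) `^ (2 * scale_exp).
Proof.
move=> t0; rewrite sqnormE normc_scale -powR_mulrn ?powR_ge0 //.
by rewrite -powRrM [2 * _]mulrC.
Qed.

Lemma scale_mulV t : 0 < t -> scale t * scale_inv t = 1.
Proof.
move=> t0; rewrite /scale_inv mulrA -sqnorm_conj sqnorm_scale // -rmorphM.
by rewrite powRN mulfV ?rmorph1 // gt_eqF // powR_gt0 // gt_gt0.
Qed.

Lemma scale_neq0 t : 0 < t -> scale t != 0.
Proof.
move=> t0; apply/eqP => h; have := scale_mulV t0; rewrite h mul0r => /eqP.
by rewrite eq_sym oner_eq0.
Qed.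

(** The exponent 1 / (4 - alpha) is the one for which |lam|^(alpha - 4) = 1 / (kappa t), the rate
    that also appears in [scale_deriv]. *)
Lemma kernel_scale t w : 0 < t ->
  kernel alpha (scale t * w) = (scale t)^* * ((growth * t)^-1)%:C * kernel alpha
    w.
Proof.
move=> t0; rewrite kernelM ?scale_neq0 // sqnorm_scale // -powRrM.
rewrite (_ : 2 * scale_exp * _ = -1) ?powR_inv1 ?ltW ?gt_gt0 //.
by rewrite /scale_exp; field; rewrite gt_eqF // subr_gt0.
Qed.

Lemma scale_deriv t : 0 < t ->
  cderiv scale t (scale t * ((a +i* b) * ((growth * t)^-1)%:C)).
Proof.
move=> t0; have g0 := growth_gt0; have gt0 := gt_gt0 t0.
pose th u := b / growth * ln u.
have dth : is_derive t 1 th (b / growth * t^-1).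
  have := is_deriveZ (b / growth) (is_derive1_ln t0).
  by apply: is_derive_ext.
have dr : is_derive t 1 (fun u => (growth * u) `^ scale_exp)
    (scale_exp * (growth * t) `^ (scale_exp - 1) * growth).
  have dg : is_derive t 1 (fun u : R => growth * u) growth.
    by apply: is_derive_ext (is_deriveZ growth (is_derive_id t 1)) => // ;
      rewrite /GRing.scale /= mulr1.
  exact: (is_derive1_comp (g := fun u => growth * u) (is_derive1_powR scale_exp
    gt0) dg).
have dc := is_derive1_comp (g := th) (is_derive_cos (th t)) dth.
have ds := is_derive1_comp (g := th) (is_derive_sin (th t)) dth.
have h1 : cderiv (fun u => ((growth * u) `^ scale_exp)%:C) t
   (scale_exp * (growth * t) `^ (scale_exp - 1) * growth)%:C.
  by split; [exact: dr|exact: is_derive_cst].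
have h2 : cderiv (fun u => cos (th u) +i* sin (th u)) t
   ((- sin (th t) * (b / growth * t^-1)) +i* (cos (th t) * (b / growth *
     t^-1))).
  by split; [exact: dc|exact: ds].
apply: cderiv_ext (cderivM h1 h2) => //; rewrite /scale -/(th t).
rewrite powR_add // powR_inv1 ?ltW //.
set r := _ `^ _; have -> : scale_exp * (r * (growth * t)^-1) * growth
  = r * a * (growth * t)^-1.
  by rewrite /growth /scale_exp; field; rewrite !gt_eqF // subr_gt0.
have -> : b / growth * t^-1 = b * (growth * t)^-1 by field; rewrite !gt_eqF.
by move: (_^-1) (cos _) (sin _) => w u v; apply/eqP; rewrite eq_complex /=;
  apply/andP; split; apply/eqP; ring.
Qed.

Lemma cderiv_ccont (f : R -> R[i]) t v : cderiv f t v -> ccont f t.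
Proof.
by move=> [f1 f2]; split; [exact: is_derive_continuous f1|exact:
  is_derive_continuous f2].
Qed.

Lemma scale_ccont t : 0 < t -> ccont scale t.
Proof. by move=> t0; exact: cderiv_ccont (scale_deriv t0). Qed.

(** The factor t / lam multiplies the outer forcing in log time; this is the source of the size t^(1
    - p). *)
Lemma normc_scale_inv t : 0 < t ->
  normc (t%:C * scale_inv t) = growth `^ (- scale_exp) * t `^ (1 - scale_exp).
Proof.
move=> t0; have g0 := growth_gt0; rewrite /scale_inv !normcM normc_conj
  normc_scale !normc_real.
rewrite (gtr0_norm t0) (gtr0_norm (powR_gt0 _ (gt_gt0 t0))) -powR_add ?gt_gt0
  //.
rewrite (_ : scale_exp + - (2 * scale_exp) = - scale_exp); last by ring.
rewrite powRM ?ltW // [X in _ = _ * X]powR_add // powRr1 ?ltW //; ring.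
Qed.

Lemma scale_inv_ccont t : 0 < t -> ccont (fun u => u%:C * scale_inv u) t.
Proof.
move=> t0; apply: ccontM; first by apply: ccont_real; exact: cvg_id.
apply: ccontM; first by apply: ccont_conj; exact: scale_ccont.
apply: ccont_real; apply: (@continuous_comp _ _ _ (fun u => growth * u) (@powR R
  ^~ _)).
  by apply: cvgM; [exact: cvg_cst|exact: cvg_id].
exact: continuous_powR (gt_gt0 t0).
Qed.

End SelfSimilarScale.

(** * The coordinates (q, S) on centered displacements of the cluster *)

Section ClusterCoordinates.
Variables (R : realType) (x0 x1 x2 : R) (a0 a1 a2 : R[i]).
Implicit Types (q S : R[i]).

Hypothesis x1_neq0 : x1 != 0.
Hypothesis x2_neq0 : x2 != 0.
Hypothesis a12 : a1 != a2.
Hypothesis a0_neq0 : a0 != 0.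
Hypothesis center : x0%:C * a0 + x1%:C * a1 + x2%:C * a2 = 0.
Hypothesis inertia : x0 * sqnorm a0 + x1 * sqnorm a1 + x2 * sqnorm a2 = 0.

(* [(0, shape1, shape2)] is centered and has moment [1]. *)
Definition shape1 : R[i] := - (x1%:C * (a2^* - a1^*))^-1.
Definition shape2 : R[i] := (x2%:C * (a2^* - a1^*))^-1.

Let d_neq0 : a2^* - a1^* != 0.
Proof. by rewrite -rmorphB conjC_eq0 subr_eq0 eq_sym. Qed.

Let x1C : x1%:C != 0 :> R[i]. Proof. by rewrite eq_complex /= eqxx andbT. Qed.
Let x2C : x2%:C != 0 :> R[i]. Proof. by rewrite eq_complex /= eqxx andbT. Qed.

Let inertiaC : x0%:C * (a0^* * a0) + x1%:C * (a1^* * a1) +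
  x2%:C * (a2^* * a2) = 0.
Proof.
rewrite -![_^* * _]mulrC -!sqnorm_conj -!rmorphM -!rmorphD.
by rewrite inertia.
Qed.

(** The direction [q a] does not contribute because the inertia vanishes. *)
Lemma moment_coord q S :
  moment x0 x1 x2 a0 a1 a2 (q * a0) (q * a1 + shape1 * S) (q * a2 +
    shape2 * S) = S.
Proof.
rewrite /moment [LHS](_ : _ = q * (x0%:C * (a0^* * a0) + x1%:C * (a1^* * a1) +
  x2%:C * (a2^* * a2))
  + S * (x1%:C * shape1 * a1^* + x2%:C * shape2 * a2^*)); last by ring.
rewrite inertiaC mulr0 add0r /shape1 /shape2 -[RHS]mulr1; congr (_ * _).
by field; rewrite d_neq0 x1C x2C.
Qed.

Lemma centered_coord q S :
  x0%:C * (q * a0) + x1%:C * (q * a1 + shape1 * S) + x2%:C * (q * a2 +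
    shape2 * S) = 0.
Proof.
rewrite [LHS](_ : _ = q * (x0%:C * a0 + x1%:C * a1 + x2%:C * a2)
  + S * (x1%:C * shape1 + x2%:C * shape2)); last by ring.
rewrite center mulr0 add0r /shape1 /shape2.
rewrite (_ : _ + _ = 0) ?mulr0 //.
by field; rewrite d_neq0 x1C x2C.
Qed.

(** Completeness of the coordinates: [q] is read off the vortex 0, where the shape vanishes, and [S]
    off the moment. *)
Lemma coord_centered (g0 g1 g2 : R[i]) :
  x0%:C * g0 + x1%:C * g1 + x2%:C * g2 = 0 ->
  let q := g0 / a0 in let S := moment x0 x1 x2 a0 a1 a2 g0 g1 g2 in
  q * a1 + shape1 * S = g1 /\ q * a2 + shape2 * S = g2.
Proof.
move=> g_centered q S.
(* Combining center and inertia eliminates the vortex 2; [key2] eliminates the vortex 1 in the same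
   way. *)
have key : x0%:C * (a2^* - a0^*) * a0 + x1%:C * (a2^* - a1^*) * a1 = 0.
  rewrite [LHS](_ : _ = a2^* * (x0%:C * a0 + x1%:C * a1 + x2%:C * a2)
    - (x0%:C * (a0^* * a0) + x1%:C * (a1^* * a1) + x2%:C * (a2^* * a2)));
      last by ring.
  by rewrite center inertiaC mulr0 subrr.
have key2 : x0%:C * (a1^* - a0^*) * a0 + x2%:C * (a1^* - a2^*) * a2 = 0.
  rewrite [LHS](_ : _ = a1^* * (x0%:C * a0 + x1%:C * a1 + x2%:C * a2)
    - (x0%:C * (a0^* * a0) + x1%:C * (a1^* * a1) + x2%:C * (a2^* * a2)));
      last by ring.
  by rewrite center inertiaC mulr0 subrr.
have SE1 : S = - (x0%:C * (a2^* - a0^*) * g0) - x1%:C * (a2^* - a1^*) * g1.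
  apply/eqP; rewrite -subr_eq0; apply/eqP.
  rewrite -(mulr0 (a2^*)) -g_centered /S /moment; ring.
have SE2 : S = - (x0%:C * (a1^* - a0^*) * g0) - x2%:C * (a1^* - a2^*) * g2.
  apply/eqP; rewrite -subr_eq0; apply/eqP.
  rewrite -(mulr0 (a1^*)) -g_centered /S /moment; ring.
have x0E : x0%:C * (a2^* - a0^*) = - (x1%:C * (a2^* - a1^*) * a1) / a0.
  by apply: (mulIf a0_neq0); rewrite divfK //; apply/eqP;
    rewrite -subr_eq0 opprK key.
have x0E2 : x0%:C * (a1^* - a0^*) = - (x2%:C * (a1^* - a2^*) * a2) / a0.
  by apply: (mulIf a0_neq0); rewrite divfK //; apply/eqP;
    rewrite -subr_eq0 opprK key2.
split.
  by rewrite SE1 x0E /shape1 /q; field; rewrite a0_neq0 d_neq0 x1C.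
by rewrite SE2 x0E2 /shape2 /q; field; rewrite a0_neq0 d_neq0 x2C.
Qed.

End ClusterCoordinates.

Section ClusterVelocity.
Variable R : realType.

Lemma cderiv_real (r : R -> R) (t d : R) : is_derive t 1 r d ->
  cderiv (fun u => (r u)%:C) t d%:C.
Proof. by move=> dr; split => //; exact: is_derive_cst. Qed.

(* Left: velocity of [X + w * z], with [w] the self-similar scale, [w'] its
   inverse, [d] the velocity of [X] and [z] a cluster vortex in the scaled
     frame.
   Right: [f] is the conjugate field of the cluster and [e] the outer one. *)
Lemma cluster_velocity (t k : R) (w w' l f e z d : R[i]) : t != 0 -> k != 0 ->
  w * w' = 1 ->
  d + (w * (l * ((k * t)^-1)%:C) * z
    + w * (((k^-1)%:C * (f - l * z) + t%:C * w' * (e - d)) * (t^-1)%:C)) =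
  w * ((k * t)^-1)%:C * f + e.
Proof.
move=> t0 k0 ww'.
have tt : t%:C * (t^-1)%:C = 1 :> R[i] by rewrite -rmorphM mulfV.
have kt : ((k * t)^-1)%:C = (k^-1)%:C * (t^-1)%:C :> R[i]
  by rewrite -rmorphM -invfM.
rewrite kt [LHS](_ : _ = w * ((k^-1)%:C * (t^-1)%:C) * f
  + (d + (w * w') * (t%:C * (t^-1)%:C) * (e - d))); last by ring.
by rewrite ww' tt !mul1r; ring.
Qed.

Lemma conj_scaled (u w : R[i]) (r : R) : u * r%:C * w^* = (u^* * r%:C * w)^*.
Proof. by rewrite !rmorphM /= conjCK conj_real. Qed.

End ClusterVelocity.

Section WeightedSums.
Variables (R : realType) (x0 x1 x2 : R).
Implicit Types u : R[i].

Lemma weighted_conj u0 u1 u2 : x0%:C * u0 + x1%:C * u1 + x2%:C * u2 = 0 ->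
  x0%:C * u0^* + x1%:C * u1^* + x2%:C * u2^* = 0.
Proof.
move=> h; rewrite -[RHS](rmorph0 Num.conj) -h !rmorphD !rmorphM /=.
by rewrite !conj_real.
Qed.

(** [w] is the weighted mean of the conjugates, and subtracting it centers them. It exists because
    the total intensity is nonzero. *)
Lemma weighted_centered u0 u1 u2 : x0 + x1 + x2 != 0 ->
  let w := ((x0 + x1 + x2)^-1)%:C * (x0%:C * u0 + x1%:C * u1 + x2%:C * u2)^* in
  x0%:C * (u0^* - w) + x1%:C * (u1^* - w) + x2%:C * (u2^* - w) = 0.
Proof.
move=> h w; have hC : x0%:C + x1%:C + x2%:C != 0 :> R[i].
  by rewrite -!rmorphD eq_complex /= eqxx andbT.
have -> : w = (x0%:C + x1%:C + x2%:C)^-1 * (x0%:C * u0^* + x1%:C * u1^* +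
  x2%:C * u2^*).
  by rewrite /w fmorphV !rmorphD !rmorphM /= !conj_real.
by field.
Qed.

Lemma weighted_combination (k l s : R[i]) f0 f1 f2 a0 a1 a2 v0 v1 v2 t0 t1 t2 :
  x0%:C * f0 + x1%:C * f1 + x2%:C * f2 = 0 ->
  x0%:C * a0 + x1%:C * a1 + x2%:C * a2 = 0 ->
  x0%:C * v0 + x1%:C * v1 + x2%:C * v2 = 0 ->
  x0%:C * t0 + x1%:C * t1 + x2%:C * t2 = 0 ->
  x0%:C * (k * (f0 - l * (a0 + v0)) + s * t0) + x1%:C * (k * (f1 - l * (a1 +
    v1)) + s * t1)
  + x2%:C * (k * (f2 - l * (a2 + v2)) + s * t2) = 0.
Proof.
move=> hf ha hv ht.
rewrite [LHS](_ : _ = k * ((x0%:C * f0 + x1%:C * f1 + x2%:C * f2)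
  - l * ((x0%:C * a0 + x1%:C * a1 + x2%:C * a2) + (x0%:C * v0 + x1%:C * v1 +
    x2%:C * v2)))
  + s * (x0%:C * t0 + x1%:C * t1 + x2%:C * t2)); last by ring.
by rewrite hf ha hv ht addr0 mulr0 subr0 !mulr0 addr0.
Qed.

End WeightedSums.

(** * The vortex system indexed by natural numbers *)

Section VortexSums.
Variables (R : realType) (alpha : R).

Definition vortex_rhs n (xi : nat -> R) (z : nat -> R[i]) (j : nat) : R[i] :=
  'i * (c_ alpha)%:C * \sum_(k < n | k != j :> nat) (xi k)%:C * kernel alpha (z
    j - z k).

Lemma pv_rhsE n (xi : 'I_n -> R) (z : 'I_n -> R[i]) (xi' : nat
  -> R) (z' : nat -> R[i]) (j : 'I_n) :
  (forall k : 'I_n, xi k = xi' k) -> (forall k : 'I_n, z k = z' k) ->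
  pv_rhs alpha xi z j = vortex_rhs n xi' z' j.
Proof.
move=> hx hz; congr (_ * _); apply: eq_big => // k _.
by rewrite kernelE hx !hz.
Qed.

(** Separates the action of the outer vortices from the three-body field. With n = 0 it also serves
    to read the equations of Hypothesis A. *)
Lemma vortex_rhs_cluster n (xi : nat -> R) (z : nat -> R[i]) c : (c < 3)%N ->
  vortex_rhs n.+3 xi z (n + c) =
  'i * (c_ alpha)%:C * \sum_(k < n) (xi k)%:C * kernel alpha (z (n + c)%N - z k)
  + nth (fun _ _ _ => 0)
      [:: field0 alpha (c_ alpha) (xi n.+1) (xi n.+2);
          field1 alpha (c_ alpha) (xi n) (xi n.+2);
          field2 alpha (c_ alpha) (xi n) (xi n.+1)] c (z n) (z n.+1) (z n.+2).
Proof.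
move=> c3; rewrite /vortex_rhs !(big_mkcond (fun k : 'I_ _ => _ != _))
  !big_ord_recr /=.
have -> : \sum_(i < n) (if i != (n + c)%N :> nat
      then (xi i)%:C * kernel alpha (z (n + c)%N - z i) else 0) =
    \sum_(k < n) (xi k)%:C * kernel alpha (z (n + c)%N - z k).
  apply: eq_bigr => i _; rewrite ifT //.
  by rewrite ltn_eqF // (leq_trans (ltn_ord i)) // leq_addr.
case: c c3 => [|[|[|//]]] _; rewrite ?addn0 ?addn1 ?addn2 /=.
- have -> : (n != n) = false by rewrite eqxx.
  have -> : n.+1 != n by lia.
  have -> : n.+2 != n by lia.
  by rewrite /field0; ring.
- have -> : (n.+1 != n.+1) = false by rewrite eqxx.
  have -> : n != n.+1 by lia.
  have -> : n.+2 != n.+1 by lia.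
  rewrite /field1 (_ : z n.+1 - z n = - (z n - z n.+1)); last by ring.
  by rewrite kernelN; ring.
- have -> : (n.+2 != n.+2) = false by rewrite eqxx.
  have -> : n != n.+2 by lia.
  have -> : n.+1 != n.+2 by lia.
  rewrite /field2 (_ : z n.+2 - z n = - (z n - z n.+2)); last by ring.
  rewrite (_ : z n.+2 - z n.+1 = - (z n.+1 - z n.+2)); last by ring.
  by rewrite !kernelN; ring.
Qed.

End VortexSums.

(** * The equations for the state and the burst they produce *)

Section Burst.
Variables (R : realType) (n : nat) (alpha a b : R).
Variables (xi : nat -> R) (y : nat -> R[i]) (a0 a1 a2 : R[i]).
Hypothesis alpha_lt3 : alpha < 3.
Hypothesis a_gt0 : 0 < a.
Hypothesis a0_neq0 : a0 != 0.
Hypothesis a01 : a0 != a1.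
Hypothesis a02 : a0 != a2.
Hypothesis a12 : a1 != a2.
Hypothesis y_inj : forall j k, (j <= n)%N -> (k <= n)%N -> y j = y k -> j = k.

Local Notation x0 := (xi n).
Local Notation x1 := (xi n.+1).
Local Notation x2 := (xi n.+2).
Local Notation ic := ('i * (c_ alpha)%:C : R[i]).
Local Notation kappa := (growth alpha a).
Local Notation p := (scale_exp alpha).
Local Notation lam := (scale alpha a b).
Local Notation lamV := (scale_inv alpha a b).
Local Notation l := (a -i* b).

Hypothesis x1_neq0 : x1 != 0.
Hypothesis x2_neq0 : x2 != 0.
Hypothesis x_neq0 : x0 + x1 + x2 != 0.
Hypothesis F0 : field0 alpha (c_ alpha) x1 x2 a0 a1 a2 = a0^* * l.
Hypothesis F1 : field1 alpha (c_ alpha) x0 x2 a0 a1 a2 = a1^* * l.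
Hypothesis F2 : field2 alpha (c_ alpha) x0 x1 a0 a1 a2 = a2^* * l.

Let alpha_lt4 : alpha < 4. Proof. by apply: (lt_trans alpha_lt3);
  rewrite ltr_nat. Qed.
Let kappa_gt0 : 0 < kappa. Proof. exact: growth_gt0. Qed.

Let p_gt0 : 0 < p. Proof. by rewrite invr_gt0 subr_gt0. Qed.
Let p_lt1 : p < 1.
Proof. by rewrite invf_lt1 ?subr_gt0 //; have := alpha_lt3; lra. Qed.

(* The forcing of the cluster by the other vortices is [O(t^(1 - p))], while
   the linearized self-similar dynamics has growth exponents at most
   [max(0, 1 - 2 p)]; [mu] lies in between. *)
Let mu : R := (Num.max 0 (1 - 2 * p) + (1 - p)) / 2.

Let mu_gt0 : 0 < mu.
Proof.
have h : 0 <= Num.max 0 (1 - 2 * p) by rewrite le_max lexx.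
by rewrite /mu; have := p_lt1; lra.
Qed.

Let mu_ltp : mu < 1 - p.
Proof.
have h : Num.max 0 (1 - 2 * p) < 1 - p.
  by rewrite gt_max; apply/andP; split; have := p_lt1; have := p_gt0; lra.
by rewrite /mu; lra.
Qed.

Let mu_gt2p : 1 - 2 * p < mu.
Proof.
have h : 1 - 2 * p <= Num.max 0 (1 - 2 * p) by rewrite le_max lexx orbT.
by rewrite /mu; have := p_gt0; lra.
Qed.

Let mu_lt1 : mu < 1. Proof. by have := mu_ltp; have := p_gt0; lra. Qed.

Let J : finType := ('I_n.+3 * bool)%type.
Implicit Types (m : J -> R) (t : R).

Let st k h m : R := m (inord k, h).
Let cz k m : R[i] := (st k false m)%:C + 'i * (st k true m)%:C.

(* Coordinates of the state: [cz k] is the displacement of the outer vortex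
   [k < n] and, for [k = n], of the center of the cluster; the shape of the
   cluster relative to its self-similar motion is [q a + S shape] with
   [q = cz n.+1], and the coordinates [n.+2] are [Re S] and [Im (l S)]. *)
Let SA : R[i] := 1 +i* (b / a).
Let SB : R[i] := 0 +i* a^-1.
Let S m : R[i] := (st n.+2 false m)%:C * SA + (st n.+2 true m)%:C * SB.
Let q m : R[i] := cz n.+1 m.
Let sh1 : R[i] := shape1 x1 a1 a2.
Let sh2 : R[i] := shape2 x2 a1 a2.
Let v0 m : R[i] := q m * a0.
Let v1 m : R[i] := q m * a1 + sh1 * S m.
Let v2 m : R[i] := q m * a2 + sh2 * S m.

Let pos (k : nat) t m : R[i] :=
  if (k < n)%N then y k + cz k m
  else y n + cz n m + lam t *
    nth 0 [:: a0 + v0 m; a1 + v1 m; a2 + v2 m] (k - n).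

Let outer (k : nat) t m : R[i] :=
  ic * \sum_(j < n) (xi j)%:C * kernel alpha (pos k t m - pos j t m).

(** Internal forces cancel in the weighted mean, so this is the velocity required of the center; the
    conjugate turns conjugate velocities into velocities. *)
Let drift t m : R[i] := ((x0 + x1 + x2)^-1)%:C *
  (x0%:C * outer n t m + x1%:C * outer n.+1 t m + x2%:C * outer n.+2 t m)^*.

Let tide k t m : R[i] := (outer k t m)^* - drift t m.

Let KR01 m := kernel_remainder alpha (a0 - a1) (v0 m - v1 m).
Let KR02 m := kernel_remainder alpha (a0 - a2) (v0 m - v2 m).
Let KR12 m := kernel_remainder alpha (a1 - a2) (v1 m - v2 m).
Let rem0 m : R[i] := ic * (x1%:C * KR01 m + x2%:C * KR02 m).
Let rem1 m : R[i] := ic * (- (x0%:C * KR01 m) + x2%:C * KR12 m).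
Let rem2 m : R[i] := ic * (- (x0%:C * KR02 m) - x1%:C * KR12 m).

(** The part of the log-time equation that is not linear in v: the Taylor remainder of the cluster
    field, and the tide, divided by [lam] since v is measured in the expanding frame. *)
Let gs (rem : (J -> R) -> R[i]) k t m : R[i] :=
  (kappa^-1)%:C * (rem m)^* + (t%:C * lamV t) * tide k t m.
Let gs0 := gs rem0 n.
Let gs1 := gs rem1 n.+1.
Let gs2 := gs rem2 n.+2.

Let mom (g0 g1 g2 : R[i]) : R[i] := moment x0 x1 x2 a0 a1 a2 g0 g1 g2.

Let regular_eq w w' (W : R -> (J -> R) -> R[i]) : w
  = w' -> regular mu w W -> regular mu w' W.
Proof. by move=> ->. Qed.

Let regular_st k h : regular mu 0 (fun _ m => (st k h m)%:C).
Proof. exact: regular_coord. Qed.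

Let regular_cz k : regular mu 0 (fun _ m => cz k m).
Proof.
apply: (regular_eq _ (regularD (regular_st k false) (regularZ 'i (regular_st k
  true)))).
by rewrite mulr0 addr0.
Qed.

Let regular_S : regular mu 0 (fun _ m => S m).
Proof.
apply: (regular_eq _ (regularD (regularM (regular_st n.+2 false) (regular_cst _
  _ SA))
  (regularM (regular_st n.+2 true) (regular_cst _ _ SB)))).
by rewrite !mul0r addr0.
Qed.

Let regular_v0 : regular mu 0 (fun _ m => v0 m).
Proof.
apply: (regular_eq _ (regularM (regular_cz n.+1) (regular_cst _ _ a0))).
by rewrite mul0r.
Qed.

Let regular_v1 : regular mu 0 (fun _ m => v1 m).
Proof.
apply: (regular_eq _ (regularD (regularM (regular_cz n.+1) (regular_cst _ _ a1))
  (regularZ sh1 regular_S))).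
by rewrite mul0r mulr0 addr0.
Qed.

Let regular_v2 : regular mu 0 (fun _ m => v2 m).
Proof.
apply: (regular_eq _ (regularD (regularM (regular_cz n.+1) (regular_cst _ _ a2))
  (regularZ sh2 regular_S))).
by rewrite mul0r mulr0 addr0.
Qed.

Let regular_lam : regular mu 0 (fun t (_ : J -> R) => lam t).
Proof.
apply: regular_time.
  by apply: filterS (near0_gt0 R) => t t0; exact: scale_ccont.
move=> e e0; have k0 : 0 < kappa `^ p by exact: powR_gt0.
have e'0 : 0 < e / kappa `^ p by rewrite divr_gt0.
apply: filterS2 (near0_gt0 R) (powR_small p_gt0 e'0) => t t0 ht.
rewrite normc_scale // powRM ?(ltW kappa_gt0) ?(ltW t0) //.
by move: ht; rewrite ler_pdivlMr // [_ * kappa `^ _]mulrC.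
Qed.

Let regular_pos k : (k < n.+3)%N -> regular mu (y (minn k n)) (pos k).
Proof.
move=> kn; rewrite /pos; have [kn'|nk] := ltnP k n.
  by apply: (regular_eq _ (regularD (regular_cst _ _ (y k)) (regular_cz k)));
    rewrite addr0.
have [w hw] : exists w, regular mu w
   (fun _ m => nth 0 [:: a0 + v0 m; a1 + v1 m; a2 + v2 m] (k - n)).
  have : (k - n < 3)%N by rewrite ltn_subLR // addn3.
  case: (k - n)%N => [|[|[|//]]] _ /=.
  - by exists (a0 + 0); exact: (regularD (regular_cst _ _ a0) regular_v0).
  - by exists (a1 + 0); exact: (regularD (regular_cst _ _ a1) regular_v1).
  - by exists (a2 + 0); exact: (regularD (regular_cst _ _ a2) regular_v2).
apply: (regular_eq _ (regularD (regularD (regular_cst _ _ (y n)) (regular_cz n))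
  (regularM regular_lam hw))).
by rewrite mul0r !addr0.
Qed.

Let regular_interaction k j : (k < n.+3)%N -> (j < n.+3)%N
  -> minn k n != minn j n ->
  regular mu (kernel alpha (y (minn k n) - y (minn j n)))
    (fun t m => kernel alpha (pos k t m - pos j t m)).
Proof.
move=> kn jn kj; apply: regular_kernel => //.
  by rewrite subr_eq0; apply: contra kj => /eqP/y_inj ->; rewrite // geq_minr.
by apply: regularB; exact: regular_pos.
Qed.

Let outer_reg k : (n <= k < n.+3)%N -> exists w, regular mu w (outer k).
Proof.
move=> /andP[nk kn]; eexists; apply: regularZ => //.
apply: (@regular_sum _ _ _ _ _ _ (fun j : 'I_n => (xi j)%:C * kernel alpha (y
  (minn k n) - y (minn j n)))) => // j _.
apply: regularZ; apply: regular_interaction => //.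
  by rewrite (ltn_trans (ltn_ord j)) // -addn3 -[X in (X < _)%N]addn0 ltn_add2l.
by rewrite (minn_idPr nk) (minn_idPl (ltnW (ltn_ord j))) gtn_eqF.
Qed.

Let force_reg k : (k < n)%N ->
  exists w, regular mu w (fun t m => (vortex_rhs alpha n.+3 xi (fun j => pos j t
    m) k)^*).
Proof.
move=> kn; eexists; apply: regular_conj => //; apply: regularZ => //.
apply: (@regular_sum _ _ _ _ _ _ (fun j : 'I_n.+3 => (xi j)%:C * kernel alpha (y
  (minn k n) - y (minn j n)))) => // j jk.
apply: regularZ; apply: regular_interaction => //.
  by rewrite (ltn_trans kn) // -addn3 -[X in (X < _)%N]addn0 ltn_add2l.
rewrite (minn_idPl (ltnW kn)); case: (leqP n j) => [nj|jn];
  first by rewrite ltn_eqF.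
by rewrite eq_sym.
Qed.

Let outer_reg' k c : k = (n + c)%N -> (c < 3)%N
  -> exists w, regular mu w (outer k).
Proof. by move=> -> c3; apply: outer_reg; rewrite leq_addr /= -addn3 ltn_add2l.
  Qed.

Let outer_reg0 : exists w, regular mu w (outer n).
Proof. by apply: (@outer_reg' _ 0); rewrite ?addn0. Qed.
Let outer_reg1 : exists w, regular mu w (outer n.+1).
Proof. by apply: (@outer_reg' _ 1); rewrite ?addn1. Qed.
Let outer_reg2 : exists w, regular mu w (outer n.+2).
Proof. by apply: (@outer_reg' _ 2); rewrite ?addn2. Qed.

Let drift_reg : exists w, regular mu w drift.
Proof.
have [w0 h0] := outer_reg0; have [w1 h1] := outer_reg1;
  have [w2 h2] := outer_reg2.
eexists; refine (regularZ ((x0 + x1 + x2)^-1)%:C (regular_conj (regularD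
  (regularD
  (regularZ x0%:C h0) (regularZ x1%:C h1)) (regularZ x2%:C h2)))).
Qed.

Let tide_reg k : (exists w, regular mu w (outer k))
  -> exists w, regular mu w (tide k).
Proof.
move=> [w hw]; have [w' hw'] := drift_reg.
eexists; refine (regularB (regular_conj hw) hw').
Qed.

Let S_zero : S (fun=> 0) = 0. Proof. by rewrite /S /st !mul0r addr0. Qed.
Let cz_zero k : cz k (fun=> 0) = 0. Proof. by rewrite /cz /st mulr0 addr0. Qed.
Let v_zero : [/\ v0 (fun=> 0) = 0, v1 (fun=> 0) = 0 & v2 (fun=> 0) = 0].
Proof. by rewrite /v0 /v1 /v2 /q S_zero cz_zero !mul0r !mulr0 !addr0. Qed.

Let KR01_small : small mu (fun _ m => KR01 m).
Proof.
have [z0 z1 _] := v_zero.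
apply: (@small_remainder _ _ _ _ _ (fun _ m => v0 m - v1 m));
  first by rewrite subr_eq0.
  by apply: (regular_eq _ (regularB regular_v0 regular_v1)); rewrite subrr.
by move=> t; rewrite z0 z1 subrr.
Qed.

Let KR02_small : small mu (fun _ m => KR02 m).
Proof.
have [z0 _ z2] := v_zero.
apply: (@small_remainder _ _ _ _ _ (fun _ m => v0 m - v2 m));
  first by rewrite subr_eq0.
  by apply: (regular_eq _ (regularB regular_v0 regular_v2)); rewrite subrr.
by move=> t; rewrite z0 z2 subrr.
Qed.

Let KR12_small : small mu (fun _ m => KR12 m).
Proof.
have [_ z1 z2] := v_zero.
apply: (@small_remainder _ _ _ _ _ (fun _ m => v1 m - v2 m));
  first by rewrite subr_eq0.
  by apply: (regular_eq _ (regularB regular_v1 regular_v2)); rewrite subrr.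
by move=> t; rewrite z1 z2 subrr.
Qed.

Let small_N (W : R -> (J -> R) -> R[i]) : small mu W -> small mu (fun t m =>
  - W t m).
Proof.
move=> /(smallZ (-1)); rewrite (_ : (fun t m => _) = (fun t m => - W t m)) //.
by do 2!apply/funext => ?; rewrite mulN1r.
Qed.

Let rem0_small : small mu (fun _ m => rem0 m).
Proof. exact: (smallZ ic (smallD (smallZ x1%:C KR01_small) (smallZ x2%:C
  KR02_small))). Qed.
Let rem1_small : small mu (fun _ m => rem1 m).
Proof. exact: (smallZ ic (smallD (small_N (smallZ x0%:C KR01_small)) (smallZ
  x2%:C KR12_small))). Qed.
Let rem2_small : small mu (fun _ m => rem2 m).
Proof. exact: (smallZ ic (smallB (small_N (smallZ x0%:C KR02_small)) (smallZ
  x1%:C KR12_small))). Qed.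

Let gs_small rem k : small mu (fun _ m => rem m) ->
  (exists w, regular mu w (outer k)) -> small mu (gs rem k).
Proof.
move=> hrem /tide_reg[w hw].
apply: (smallD (smallZ (kappa^-1)%:C (small_conj hrem))).
apply: (@small_time _ _ _ mu_gt0 (1 - p) (kappa `^ (- p)) (fun t => t%:C * lamV
  t) w (tide k)) => //.
  by apply: filterS (near0_gt0 R) => t t0; exact: scale_inv_ccont.
by apply: filterS (near0_gt0 R) => t t0; rewrite normc_scale_inv.
Qed.

Let gs0_small : small mu gs0. Proof. exact: (gs_small rem0_small outer_reg0).
  Qed.
Let gs1_small : small mu gs1. Proof. exact: (gs_small rem1_small outer_reg1).
  Qed.
Let gs2_small : small mu gs2. Proof. exact: (gs_small rem2_small outer_reg2).
  Qed.

Let small_tM w (W : R -> (J -> R) -> R[i]) : regular mu w W ->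
  small mu (fun t m => t%:C * W t m).
Proof.
apply: (@small_time _ _ _ mu_gt0 1 1 (fun t => t%:C)) => //.
  by apply: nearW => t; apply: ccont_real; exact: cvg_id.
apply: filterS (near0_gt0 R) => t t0.
by rewrite normc_real gtr0_norm // powRr1 ?(ltW t0) // mul1r.
Qed.

Let pert_c (k : nat) (h : bool) t m : R[i] :=
  if (k < n)%N then t%:C * (vortex_rhs alpha n.+3 xi (fun j => pos j t m) k)^*
  else if k == n then t%:C * drift t m
  else if k == n.+1 then a0^-1 * gs0 t m
  else (if h then l else 1) * mom (gs0 t m) (gs1 t m) (gs2 t m).

(** State coordinates are real and use the real part of [pert]; the factor - i makes that part the
    imaginary part of [pert_c]. *)
Let pert (i : J) t m : R[i] := (if i.2 then - 'i else 1) * pert_c i.1 i.2 t m.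

Let pert_small i : small mu (pert i).
Proof.
suff h k g : small mu (pert_c k g) by exact: (smallZ (if i.2 then
  - 'i else 1) (h i.1 i.2)).
rewrite /pert_c; case: ltnP => [kn|_].
  by have [w hw] := force_reg kn; exact: small_tM hw.
case: eqP => _; first by have [w hw] := drift_reg; exact: small_tM hw.
case: eqP => _; first exact: (smallZ a0^-1 gs0_small).
exact: (smallZ (if g then l else 1) (smallD (smallD (smallZ x0%:C (smallZ a0^*
  gs0_small))
  (smallZ x1%:C (smallZ a1^* gs1_small))) (smallZ x2%:C (smallZ a2^*
    gs2_small)))).
Qed.

Let sg (i : J) : R :=
  if (i.1 == n.+1 :> nat) then (if i.2 then 0 else -1)
  else if (i.1 == n.+2 :> nat) then (if i.2 then (2 - alpha) * p else - (2 * p))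
  else 0.

Let sg_lt i : sg i < mu.
Proof.
(* The exponent given by the Hamiltonian is the 1 - 2 p that [mu] was chosen to exceed. *)
have h : (2 - alpha) * p = 1 - 2 * p.
  by rewrite /scale_exp; field; rewrite gt_eqF // subr_gt0.
have := mu_gt0; have := mu_gt2p; have := p_gt0.
by rewrite /sg; do ?case: ifP => _; rewrite ?h; lra.
Qed.

(** Order of the triangular coupling: S drives Re q, and S together with Re q drives Im q. The
    remaining coordinates take part in no coupling. *)
Let rk (i : J) : nat :=
  if (i.1 == n.+1 :> nat) then (if i.2 then 2 else 1)
  else if (i.1 == n.+2 :> nat) then 0 else 2.

Let rk_le i : (rk i <= 2)%N.
Proof. by rewrite /rk; do ?case: ifP => _. Qed.

(** Effect of S on q through the vortex 0, for the two basis vectors of S. The frame term is absent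
    because the shape has zero component there. *)
Let QA : R[i] := (kappa^-1)%:C *
  (dfield0 alpha (c_ alpha) x1 x2 a0 a1 a2 0 (sh1 * SA) (sh2 * SA))^* / a0.
Let QB : R[i] := (kappa^-1)%:C *
  (dfield0 alpha (c_ alpha) x1 x2 a0 a1 a2 0 (sh1 * SB) (sh2 * SB))^* / a0.
Let Q m : R[i] := (st n.+2 false m)%:C * QA + (st n.+2 true m)%:C * QB.

Let lin (i : J) m : R :=
  if (i.1 == n.+1 :> nat) then
    (if i.2 then complex.Im (Q m) - b / a * st n.+1 false m else complex.Re (Q
      m))
  else 0.

Let lin_zero i : lin i (fun=> 0) = 0.
Proof.
by rewrite /lin /Q /st !mul0r addr0 mulr0 subrr; do ?case: ifP => _.
Qed.

Let lin_lip i m m' E : 0 <= E -> (forall j, (rk j < rk i)%N -> `|m j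
  - m' j| <= E) ->
  `|lin i m - lin i m'| <= (normc QA + normc QB + `|b / a|) * E.
Proof.
move=> E0 hE; have nA := normc_ge0 QA; have nB := normc_ge0 QB.
have nb := normr_ge0 (b / a).
rewrite /lin; case: ifP => [/eqP i1|_]; last first.
  by rewrite subrr normr0 mulr_ge0 // !addr_ge0.
have rS h : (rk (inord n.+2, h) < rk i)%N.
  rewrite /rk /= inordK // i1 !eqxx (_ : (n.+2 == n.+1) = false);
    last by rewrite gtn_eqF.
  by case: (i.2).
have hS h : `|st n.+2 h m - st n.+2 h m'| <= E
  by exact: (hE (inord n.+2, h) (rS h)).
have hQ : normc (Q m - Q m') <= (normc QA + normc QB) * E.
  rewrite (_ : Q m - Q m' = (st n.+2 false m - st n.+2 false m')%:C * QA
    + (st n.+2 true m - st n.+2 true m')%:C * QB); last by rewrite /Q; ring.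
  rewrite (le_trans (normcD _ _)) // (normcM _ QA) (normcM _ QB) !normc_real
    mulrDl.
  apply: lerD; rewrite [leLHS]mulrC; apply: ler_wpM2l.
  - exact: nA.
  - exact: hS.
  - exact: nB.
  - exact: hS.
case: ifP => [i2|_]; last first.
  rewrite -ReN -ReD (le_trans (normc_Re _)) // (le_trans hQ) // ler_wpM2r //.
  by rewrite lerDl.
have -> : complex.Im (Q m) - b / a * st n.+1 false m - (complex.Im (Q m')
  - b / a * st n.+1 false m')
  = complex.Im (Q m - Q m') - b / a * (st n.+1 false m - st n.+1 false m').
  by rewrite ImD ImN; ring.
rewrite (le_trans (ler_normB _ _)) // [leRHS]mulrDl lerD //.
  exact: le_trans (normc_Im _) hQ.
rewrite normrM ler_wpM2l //; apply: (hE (inord n.+1, false)).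
by rewrite /rk /= inordK // i1 i2 eqxx.
Qed.

Let lin_cont i (m : R -> J -> R) t : (forall j, {for t, continuous (m^~ j)}) ->
  {for t, continuous (fun u => lin i (m u))}.
Proof.
move=> cm; have cQ : ccont (fun u => Q (m u)) t.
  by apply: ccontD; apply: ccontM; try exact: ccont_cst; apply: ccont_real;
    exact: cm.
rewrite /lin; case: (_ == _); last exact: cvg_cst.
case: (i.2); last exact: cQ.1.
by apply: cvgB; [exact: cQ.2|apply: cvgM; [exact: cvg_cst|exact: cm]].
Qed.

Let state_curve : exists2 T, 0 < T & exists m : R -> J -> R,
  forall t, 0 < t < T -> ubox mu t (m t) /\ forall i,
    is_derive t 1 (m^~ i)
      ((sg i * m t i + (lin i (m t) + complex.Re (pert i t (m t)))) / t).
Proof.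
have C0 : 0 <= normc QA + normc QB + `|b / a|.
  by rewrite !addr_ge0 ?normc_ge0.
exact: (small_perturbation_ode mu_gt0 C0 sg_lt rk_le lin_zero lin_lip lin_cont
  pert_small).
Qed.

Let regular_neq0 w (W : R -> (J -> R) -> R[i]) : w != 0 -> regular mu w W ->
  \forall t \near 0^'+, forall m, ubox mu t m -> W t m != 0.
Proof.
move=> w0 [_ tW _]; have w20 : 0 < normc w / 2 by rewrite divr_gt0 // normc_gt0.
apply: filterS (tW _ w20) => t h m /h; have := normc_gt0 w0.
by move=> wpos; apply: contraTneq => ->; rewrite sub0r normcN; lra.
Qed.

Let shape_c (c : nat) m : R[i] := nth 0 [:: a0 + v0 m; a1 + v1 m; a2 + v2 m] c.

Let shape_reg c : (c < 3)%N -> regular mu (nth 0 [:: a0; a1;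
  a2] c) (fun _ m => shape_c c m).
Proof.
case: c => [|[|[|//]]] _.
- by apply: (regular_eq _ (regularD (regular_cst _ _ a0) regular_v0));
  rewrite addr0.
- by apply: (regular_eq _ (regularD (regular_cst _ _ a1) regular_v1));
  rewrite addr0.
- by apply: (regular_eq _ (regularD (regular_cst _ _ a2) regular_v2));
  rewrite addr0.
Qed.

Let nth_a_inj c c' : (c < 3)%N -> (c' < 3)%N -> c != c' ->
  nth 0 [:: a0; a1; a2] c - nth 0 [:: a0; a1; a2] c' != 0.
Proof.
rewrite subr_eq0; case: c c' => [|[|[|//]]] [|[|[|//]]] //= _ _ _.
- by rewrite eq_sym.
- by rewrite eq_sym.
- by rewrite eq_sym.
Qed.

(** Vortices with distinct limits separate by continuity. Two members of the cluster differ by [lam]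
    times a difference of shapes that tends to a nonzero a_c - a_c'. *)
Let pos_distinct : \forall t \near 0^'+, forall j k : 'I_n.+3, forall m,
  ubox mu t m -> j != k -> pos j t m - pos k t m != 0.
Proof.
apply: filter_forall => j; apply: filter_forall => k.
have [_|jk] := eqVneq j k; first by apply: nearW.
suff : \forall t \near 0^'+, forall m, ubox mu t m -> pos j t m
  - pos k t m != 0.
  by apply: filterS => t h m bm _; exact: h.
have [jkm|jkm] := eqVneq (minn j n) (minn k n); last first.
  apply: (regular_neq0 _ (regularB (regular_pos (ltn_ord j)) (regular_pos
    (ltn_ord k)))).
  by rewrite subr_eq0; apply: contra jkm => /eqP/y_inj ->; rewrite // geq_minr.
have jkN : j != k :> nat by [].
have [nj nk] : (n <= j)%N /\ (n <= k)%N.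
  move: jkm jkN; case: (ltnP j n) => jn; case: (ltnP k n) => kn //.
  - by move=> ->; rewrite eqxx.
  - by move=> jE; move: jn; rewrite jE ltnn.
  - by move=> kE; move: kn; rewrite -kE ltnn.
have j3 : (j - n < 3)%N by rewrite ltn_subLR // addn3.
have k3 : (k - n < 3)%N by rewrite ltn_subLR // addn3.
have cc : (j - n)%N != (k - n)%N.
  by apply: contra jkN => /eqP e; rewrite -(subnK nj) -(subnK nk) e.
apply: filterS2 (near0_gt0 R) (regular_neq0 (nth_a_inj j3 k3 cc) (regularB
  (shape_reg j3) (shape_reg k3))).
move=> t t0 h m bm.
rewrite /pos !ltnNge nj nk /= opprD addrACA subrr add0r -mulrBr.
by rewrite mulf_neq0 ?scale_neq0 // h.
Qed.

Let f0 m := field0 alpha (c_ alpha) x1 x2 (a0 + v0 m) (a1 + v1 m) (a2 + v2 m).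
Let f1 m := field1 alpha (c_ alpha) x0 x2 (a0 + v0 m) (a1 + v1 m) (a2 + v2 m).
Let f2 m := field2 alpha (c_ alpha) x0 x1 (a0 + v0 m) (a1 + v1 m) (a2 + v2 m).

(** The intended value of t dv_0/dt, as linear part plus perturbation; [deriv_v0] confirms it along
    the solution, and likewise for [G1] and [G2]. *)
Let G0 t m : R[i] := (kappa^-1)%:C *
  lin0 alpha (c_ alpha) a b x1 x2 a0 a1 a2 (v0 m) (v1 m) (v2 m) + gs0 t m.
Let G1 t m : R[i] := (kappa^-1)%:C *
  lin1 alpha (c_ alpha) a b x0 x2 a0 a1 a2 (v0 m) (v1 m) (v2 m) + gs1 t m.
Let G2 t m : R[i] := (kappa^-1)%:C *
  lin2 alpha (c_ alpha) a b x0 x1 a0 a1 a2 (v0 m) (v1 m) (v2 m) + gs2 t m.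

Let kernel_exp u u' w w' : kernel alpha ((u + w) - (u' + w')) =
  kernel alpha (u - u') + dkernel alpha (u - u') (w - w')
  + kernel_remainder alpha (u - u') (w - w').
Proof.
rewrite (_ : u + w - (u' + w') = u - u' + (w - w')); last by ring.
by rewrite /kernel_remainder; ring.
Qed.

(** Each kernel at a + v is exactly value, differential and remainder. By [F0] the values sum to l
    times the conjugate of a0, which completes l^* v0 into l^* (a0 + v0). *)
Let G0E t m : G0 t m = (kappa^-1)%:C * ((f0 m)^* - l^* * (a0 + v0 m))
  + t%:C * lamV t * tide n t m.
Proof.
have -> : f0 m = a0^* * l + dfield0 alpha (c_ alpha) x1 x2 a0 a1 a2 (v0 m) (v1
  m) (v2 m) + rem0 m.
  by rewrite -F0 /f0 /field0 /dfield0 !kernel_exp /rem0 /KR01 /KR02; ring.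
rewrite /G0 /lin0 /gs0 /gs; move: (rem0 m) (tide n t m) (dfield0 _ _ _ _ _ _ _ _
  _ _) => r d e.
by rewrite !rmorphD rmorphM /= conjCK; ring.
Qed.

Let G1E t m : G1 t m = (kappa^-1)%:C * ((f1 m)^* - l^* * (a1 + v1 m))
  + t%:C * lamV t * tide n.+1 t m.
Proof.
have -> : f1 m = a1^* * l + dfield1 alpha (c_ alpha) x0 x2 a0 a1 a2 (v0 m) (v1
  m) (v2 m) + rem1 m.
  by rewrite -F1 /f1 /field1 /dfield1 !kernel_exp /rem1 /KR01 /KR12; ring.
rewrite /G1 /lin1 /gs1 /gs; move: (rem1 m) (tide n.+1 t m) (dfield1 _ _ _ _ _ _
  _ _ _ _) => r d e.
by rewrite !rmorphD rmorphM /= conjCK; ring.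
Qed.

Let G2E t m : G2 t m = (kappa^-1)%:C * ((f2 m)^* - l^* * (a2 + v2 m))
  + t%:C * lamV t * tide n.+2 t m.
Proof.
have -> : f2 m = a2^* * l + dfield2 alpha (c_ alpha) x0 x1 a0 a1 a2 (v0 m) (v1
  m) (v2 m) + rem2 m.
  by rewrite -F2 /f2 /field2 /dfield2 !kernel_exp /rem2 /KR02 /KR12; ring.
rewrite /G2 /lin2 /gs2 /gs; move: (rem2 m) (tide n.+2 t m) (dfield2 _ _ _ _ _ _
  _ _ _ _) => r d e.
by rewrite !rmorphD rmorphM /= conjCK; ring.
Qed.

Let center := center_eq0 a_gt0 F0 F1 F2.
Let inertia := inertia_eq0 a_gt0 F0 F1 F2.

Let tide_centered t m :
  x0%:C * tide n t m + x1%:C * tide n.+1 t m + x2%:C * tide n.+2 t m = 0.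
Proof.
exact: weighted_centered x_neq0.
Qed.

(** The constraint on v is compatible with the equations, so evolving q and S suffices to recover
    the motion of all three vortices. *)
Let G_centered t m : x0%:C * G0 t m + x1%:C * G1 t m + x2%:C * G2 t m = 0.
Proof.
rewrite G0E G1E G2E.
have hf : x0%:C * f0 m + x1%:C * f1 m + x2%:C * f2 m = 0 by exact: field_sum.
have hv : x0%:C * v0 m + x1%:C * v1 m + x2%:C * v2 m = 0.
  exact: (centered_coord x1_neq0 x2_neq0 a12 center).
have hfc : x0%:C * (f0 m)^* + x1%:C * (f1 m)^* + x2%:C * (f2 m)^* = 0.
  exact: weighted_conj hf.
have ht := tide_centered t m.
exact: weighted_combination hfc center hv ht.
Qed.

Let ReM_i (w : R[i]) : complex.Re (- 'i * w) = complex.Im w.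
Proof. by case: w => u v /=; ring. Qed.

Let ReMC (w : R[i]) (r : R) : complex.Re (w * r%:C) = complex.Re w * r.
Proof. by rewrite mulrC ReCM mulrC. Qed.

Let ImMC (w : R[i]) (r : R) : complex.Im (w * r%:C) = complex.Im w * r.
Proof. by rewrite mulrC ImCM mulrC. Qed.

(** [SA] and [SB] form the real basis dual to the functionals Re and Im (l _), which diagonalize the
    evolution of the moment. *)
Let SAB (w : R[i]) : (complex.Re w)%:C * SA + (complex.Im (l * w))%:C * SB = w.
Proof.
case: w => u v; apply/eqP; rewrite eq_complex /=; apply/andP; split; apply/eqP.
  by field; rewrite gt_eqF.
by field; rewrite gt_eqF.
Qed.

Let Re_S m : complex.Re (S m) = st n.+2 false m.
Proof. by rewrite /S /=; ring. Qed.

Let Im_lS m : complex.Im (l * S m) = st n.+2 true m.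
Proof. by rewrite /S /=; field; rewrite gt_eqF. Qed.

Let mom_v m : mom (v0 m) (v1 m) (v2 m) = S m.
Proof. exact: moment_coord. Qed.

Let momG t m : mom (G0 t m) (G1 t m) (G2 t m) = (kappa^-1)%:C *
  mom (lin0 alpha (c_ alpha) a b x1 x2 a0 a1 a2 (v0 m) (v1 m) (v2 m))
   (lin1 alpha (c_ alpha) a b x0 x2 a0 a1 a2 (v0 m) (v1 m) (v2 m))
   (lin2 alpha (c_ alpha) a b x0 x1 a0 a1 a2 (v0 m) (v1 m) (v2 m))
  + mom (gs0 t m) (gs1 t m) (gs2 t m).
Proof. exact: moment_comb. Qed.

Let kappa_p : kappa^-1 * a = p.
Proof. by rewrite /growth /scale_exp; field; rewrite !gt_eqF // subr_gt0. Qed.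

Let Re_momG t m : complex.Re (mom (G0 t m) (G1 t m) (G2 t m)) =
  - (2 * p) * st n.+2 false m + complex.Re (mom (gs0 t m) (gs1 t m) (gs2 t m)).
Proof.
rewrite momG ReD ReCM (moment_lin_Re F0 F1 F2) -/(mom _ _ _) mom_v Re_S
  -kappa_p.
by congr (_ + _); move: (st _ _ _) => s; ring.
Qed.

Let Im_momG t m : complex.Im (l * mom (G0 t m) (G1 t m) (G2 t m)) =
  (2 - alpha) * p * st n.+2 true m + complex.Im (l * mom (gs0 t m) (gs1 t m)
    (gs2 t m)).
Proof.
rewrite momG mulrDr mulrCA ImD ImCM (moment_lin_Im a01 a02 a12 F0 F1 F2).
rewrite -/(mom _ _ _) mom_v Im_lS -kappa_p.
by congr (_ + _); move: (st _ _ _) => s; ring.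
Qed.

Let dfield_S m : dfield0 alpha (c_ alpha) x1 x2 a0 a1 a2 0 (sh1 * S m) (sh2 * S
  m) =
  (st n.+2 false m)%:C * dfield0 alpha (c_ alpha) x1 x2 a0 a1 a2 0 (sh1 * SA)
    (sh2 * SA)
  + (st n.+2 true m)%:C * dfield0 alpha (c_ alpha) x1 x2 a0 a1 a2 0 (sh1 * SB)
    (sh2 * SB).
Proof.
rewrite -!dfield0Z -dfield0D !mulr0 addr0 /S.
by move: (st _ _ _) (st _ _ _) SA SB sh1 sh2 => s s' u u' w w'; congr dfield0;
  ring.
Qed.

(** The log-time equation of q: the homogeneous part q a gives the first two terms, and the shape
    part gives [Q]. *)
Let G0_a0 t m : G0 t m / a0 =
  - (complex.Re (q m))%:C - 'i * (b / a * complex.Re (q m))%:C + Q m +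
    a0^-1 * gs0 t m.
Proof.
have -> : G0 t m / a0 = (kappa^-1)%:C * (((alpha
  - 4) * complex.Re (q m))%:C * l^* * a0
   + (dfield0 alpha (c_ alpha) x1 x2 a0 a1 a2 0 (sh1 * S m) (sh2 * S m))^*) / a0
     + a0^-1 * gs0 t m.
  rewrite -(lin0_homogeneous a01 a02 F0) /lin0.
  rewrite -addrA [- _ + _]addrC addrA -rmorphD -dfield0D addr0.
  by rewrite -/(lin0 _ _ _ _ _ _ _ _ _ _ _ _) /G0 mulrDl; congr (_ + _);
    rewrite mulrC.
congr (_ + _); rewrite dfield_S mulrDr mulrDl; congr (_ + _).
  rewrite -!mulrA mulfV // mulr1.
  rewrite (_ : l^* = a%:C + 'i * b%:C); last first.
    by apply/eqP; rewrite eq_complex /=; apply/andP; split; apply/eqP; ring.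
  move: (complex.Re _) => r.
  have -> : (kappa^-1)%:C * (((alpha - 4) * r)%:C * (a%:C + 'i * b%:C)) =
     (kappa^-1 * (alpha - 4) * r * a)%:C + 'i * (kappa^-1 * (alpha
       - 4) * r * b)%:C by ring.
  have -> : kappa^-1 * (alpha - 4) = - a^-1.
    by rewrite /growth; field; rewrite !gt_eqF // subr_gt0.
  rewrite (_ : - a^-1 * r * a = - r); last by field; rewrite gt_eqF.
  by rewrite (_ : - a^-1 * r * b = - (b / a * r)); ring.
rewrite /Q /QA /QB; set u := dfield0 _ _ _ _ _ _ _ _ _ _;
  set u' := dfield0 _ _ _ _ _ _ _ _ _ _.
rewrite rmorphD !rmorphM /= !conj_real.
by move: u u' (a0^-1) (st _ _ _) (st _ _ _) => ? ? ? ? ?; ring.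
Qed.

Section AlongCurve.
Variables (m : R -> J -> R) (t : R).
Hypothesis t_gt0 : 0 < t.
Hypothesis dm : forall i, is_derive t 1 (m^~ i)
  ((sg i * m t i + (lin i (m t) + complex.Re (pert i t (m t)))) / t).

Let t_neq0 : t != 0. Proof. by rewrite gt_eqF. Qed.

Let cz_deriv k d :
  is_derive t 1 (fun u => st k false (m u)) (complex.Re d) ->
  is_derive t 1 (fun u => st k true (m u)) (complex.Im d) ->
  cderiv (fun u => cz k (m u)) t d.
Proof.
move=> d1 d2; rewrite [d]complex_ReIm.
exact: (cderivD (cderiv_real d1) (cderivZ 'i (cderiv_real d2))).
Qed.

Let sg0 k h : (k <= n)%N -> sg (inord k, h) = 0.
Proof.
move=> kn; rewrite /sg /= inordK; last by rewrite ltnS (leq_trans kn) // leqW.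
by rewrite !ltn_eqF // ltnS // leqW.
Qed.

Let lin_0 k h m' : (k <= n)%N -> lin (inord k, h) m' = 0.
Proof.
move=> kn; rewrite /lin /= inordK; last by rewrite ltnS (leq_trans kn) // leqW.
by rewrite ltn_eqF // ltnS.
Qed.

Let deriv_simple k w : (k <= n)%N -> (forall h, pert_c k h t (m t)
  = t%:C * w) ->
  cderiv (fun u => cz k (m u)) t w.
Proof.
move=> kn hp; have kn3 : (k < n.+3)%N by rewrite ltnS (leq_trans kn) // leqW.
apply: cz_deriv.
  apply: is_derive_ext (dm (inord k, false)) => //.
  rewrite sg0 // lin_0 // /pert /= inordK // hp mul0r !add0r mul1r ReCM.
  by rewrite mulrAC mulfV // mul1r.
apply: is_derive_ext (dm (inord k, true)) => //.
rewrite sg0 // lin_0 // /pert /= inordK // hp mul0r !add0r ReM_i ImCM.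
by rewrite mulrAC mulfV // mul1r.
Qed.

Let deriv_ext k : (k < n)%N -> cderiv (fun u => cz k (m u)) t
  (vortex_rhs alpha n.+3 xi (fun j => pos j t (m t)) k)^*.
Proof.
by move=> kn; apply: deriv_simple; [exact: ltnW|move=> h; rewrite /pert_c kn].
Qed.

Let deriv_X : cderiv (fun u => cz n (m u)) t (drift t (m t)).
Proof. by apply: deriv_simple => // h; rewrite /pert_c ltnn eqxx. Qed.

Let Re_q m' : complex.Re (q m') = st n.+1 false m'.
Proof. by rewrite /q /cz /=; ring. Qed.

Let n1 : (n.+1 < n.+3)%N. Proof. by []. Qed.
Let n2 : (n.+2 < n.+3)%N. Proof. by []. Qed.

Let pert_q h : pert_c n.+1 h t (m t) = a0^-1 * gs0 t (m t).
Proof. by rewrite /pert_c ltnNge leqnSn /= gtn_eqF // eqxx. Qed.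

Let pert_S h : pert_c n.+2 h t (m t) =
  (if h then l else 1) * mom (gs0 t (m t)) (gs1 t (m t)) (gs2 t (m t)).
Proof. by rewrite /pert_c ltnNge leqW // gtn_eqF 1?leqW // gtn_eqF. Qed.

Let ReG (r r' : R) (u w : R[i]) :
  complex.Re (- r%:C - 'i * r'%:C + u + w) = - r + complex.Re u + complex.Re w.
Proof. by case: u w => ? ? [? ?] /=; ring. Qed.

Let ImG (r r' : R) (u w : R[i]) :
  complex.Im (- r%:C - 'i * r'%:C + u + w) = - r' + complex.Im u + complex.Im w.
Proof. by case: u w => ? ? [? ?] /=; ring. Qed.

Let rate_q0 : sg (inord n.+1, false) * m t (inord n.+1, false)
  + (lin (inord n.+1, false) (m t) + complex.Re (pert (inord n.+1,
    false) t (m t)))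
  = complex.Re (G0 t (m t) / a0).
Proof.
have -> : sg (inord n.+1, false) = -1 by rewrite /sg /= inordK // eqxx.
have -> : lin (inord n.+1, false) (m t) = complex.Re (Q (m t))
  by rewrite /lin /= inordK // eqxx.
have -> : pert (inord n.+1, false) t (m t) = a0^-1 * gs0 t (m t).
  by rewrite /pert /= inordK // pert_q mul1r.
by rewrite G0_a0 ReG Re_q mulN1r addrA.
Qed.

Let rate_q1 : sg (inord n.+1, true) * m t (inord n.+1, true)
  + (lin (inord n.+1, true) (m t) + complex.Re (pert (inord n.+1,
    true) t (m t)))
  = complex.Im (G0 t (m t) / a0).
Proof.
have -> : sg (inord n.+1, true) = 0 by rewrite /sg /= inordK // eqxx.
have -> : lin (inord n.+1, true) (m t) = complex.Im (Q (m t))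
  - b / a * st n.+1 false (m t).
  by rewrite /lin /= inordK // eqxx.
have -> : pert (inord n.+1, true) t (m t) = - 'i * (a0^-1 * gs0 t (m t)).
  by rewrite /pert /= inordK // pert_q.
by rewrite G0_a0 ImG Re_q ReM_i mul0r add0r [- _ + _]addrC.
Qed.

Let rate_S0 : sg (inord n.+2, false) * m t (inord n.+2, false)
  + (lin (inord n.+2, false) (m t) + complex.Re (pert (inord n.+2,
    false) t (m t)))
  = complex.Re (mom (G0 t (m t)) (G1 t (m t)) (G2 t (m t))).
Proof.
have -> : sg (inord n.+2, false) = - (2 * p) by rewrite /sg /= inordK //
  gtn_eqF // eqxx.
have -> : lin (inord n.+2, false) (m t) = 0 by rewrite /lin /= inordK //
  gtn_eqF.
have -> : pert (inord n.+2, false) t (m t) = mom (gs0 t (m t)) (gs1 t (m t))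
  (gs2 t (m t)).
  by rewrite /pert /= inordK // pert_S !mul1r.
by rewrite Re_momG add0r.
Qed.

Let rate_S1 : sg (inord n.+2, true) * m t (inord n.+2, true)
  + (lin (inord n.+2, true) (m t) + complex.Re (pert (inord n.+2,
    true) t (m t)))
  = complex.Im (l * mom (G0 t (m t)) (G1 t (m t)) (G2 t (m t))).
Proof.
have -> : sg (inord n.+2, true) = (2 - alpha) * p
  by rewrite /sg /= inordK // gtn_eqF // eqxx.
have -> : lin (inord n.+2, true) (m t) = 0 by rewrite /lin /= inordK // gtn_eqF.
have -> : pert (inord n.+2, true) t (m t) =
    - 'i * (l * mom (gs0 t (m t)) (gs1 t (m t)) (gs2 t (m t))).
  by rewrite /pert /= inordK // pert_S.
by rewrite Im_momG add0r ReM_i.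
Qed.

Let deriv_q : cderiv (fun u => q (m u)) t (G0 t (m t) / a0 * (t^-1)%:C).
Proof.
apply: cz_deriv.
  apply: is_derive_ext (dm (inord n.+1, false)) => //.
  by rewrite ReMC rate_q0.
apply: is_derive_ext (dm (inord n.+1, true)) => //.
by rewrite ImMC rate_q1.
Qed.

Let deriv_S : cderiv (fun u => S (m u)) t
  (mom (G0 t (m t)) (G1 t (m t)) (G2 t (m t)) * (t^-1)%:C).
Proof.
set M := mom _ _ _.
have d1 : is_derive t 1 (fun u => st n.+2 false (m u)) (complex.Re M / t).
  by apply: is_derive_ext (dm (inord n.+2, false)) => //; rewrite rate_S0.
have d2 : is_derive t 1 (fun u => st n.+2 true (m u)) (complex.Im (l * M) / t).
  by apply: is_derive_ext (dm (inord n.+2, true)) => //; rewrite rate_S1.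
have h := cderivD (cderivM (cderiv_real d1) (cderiv_cst SA t)) (cderivM
  (cderiv_real d2) (cderiv_cst SB t)).
apply: cderiv_ext h => //.
rewrite !mulr0 !addr0 -[in RHS](SAB M) mulrDl.
move: (complex.Re M) (complex.Im (l * M)) SA SB => r r' u u'.
by rewrite !rmorphM /=; ring.
Qed.

Let deriv_v0 : cderiv (fun u => v0 (m u)) t (G0 t (m t) * (t^-1)%:C).
Proof.
apply: cderiv_ext (cderivM deriv_q (cderiv_cst a0 t)) => //.
by rewrite mulr0 addr0 mulrAC divfK.
Qed.

(** The rates of q and S are those of the triple (G0, G1, G2); since it is centered,
    [coord_centered] returns G1 itself. *)
Let deriv_v1 : cderiv (fun u => v1 (m u)) t (G1 t (m t) * (t^-1)%:C).
Proof.
have [<- _] := coord_centered x1_neq0 x2_neq0 a12 a0_neq0 center inertia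
  (G_centered t (m t)).
apply: cderiv_ext (cderivD (cderivM deriv_q (cderiv_cst a1 t)) (cderivZ sh1
  deriv_S)) => //.
rewrite mulr0 addr0 -/(mom _ _ _) -/sh1.
by move: (G0 _ _ / a0) (mom _ _ _) sh1 => u u' u''; ring.
Qed.

Let deriv_v2 : cderiv (fun u => v2 (m u)) t (G2 t (m t) * (t^-1)%:C).
Proof.
have [_ <-] := coord_centered x1_neq0 x2_neq0 a12 a0_neq0 center inertia
  (G_centered t (m t)).
apply: cderiv_ext (cderivD (cderivM deriv_q (cderiv_cst a2 t)) (cderivZ sh2
  deriv_S)) => //.
rewrite mulr0 addr0 -/(mom _ _ _) -/sh2.
by move: (G0 _ _ / a0) (mom _ _ _) sh2 => u u' u''; ring.
Qed.

Let pos0 u m' : pos n u m' = y n + cz n m' + lam u * (a0 + v0 m').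
Proof. by rewrite /pos ltnn subnn. Qed.

Let pos1 u m' : pos n.+1 u m' = y n + cz n m' + lam u * (a1 + v1 m').
Proof. by rewrite /pos ltnNge leqnSn subSnn. Qed.

Let pos2 u m' : pos n.+2 u m' = y n + cz n m' + lam u * (a2 + v2 m').
Proof. by rewrite /pos ltnNge leqW // -addn2 addKn. Qed.

Let kernel_pos d (w w' : R[i]) : kernel alpha (d + lam t * w - (d +
  lam t * w')) =
  (lam t)^* * ((kappa * t)^-1)%:C * kernel alpha (w - w').
Proof. by rewrite opprD addrACA subrr add0r -mulrBr kernel_scale. Qed.

Let z u (k : nat) : R[i] := pos k u (m u).

Let lconj : l^* = a +i* b.
Proof. by apply/eqP; rewrite eq_complex /= opprK !eqxx. Qed.

(** Product rule for y + X + lam (a + v): the drift of X cancels the one subtracted in the tide, and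
    lam' cancels the frame term l^* (a + v). *)
Let deriv_pos (v f : (J -> R) -> R[i]) (av G : R[i]) k :
  cderiv (fun u => v (m u)) t (G * (t^-1)%:C) ->
  G = (kappa^-1)%:C * ((f (m t))^* - l^* * (av + v (m t))) +
    t%:C * lamV t * tide k t (m t) ->
  cderiv (fun u => y n + cz n (m u) + lam u * (av + v (m u))) t
    (lam t * ((kappa * t)^-1)%:C * (f (m t))^* + (outer k t (m t))^*).
Proof.
move=> dv GE.
have h := cderivD (cderivD (cderiv_cst (y n) t) deriv_X)
  (cderivM (scale_deriv b alpha_lt4 a_gt0 t_gt0) (cderivD (cderiv_cst av t)
    dv)).
apply: cderiv_ext h => //.
rewrite !add0r GE -lconj.
by apply: cluster_velocity => //; [exact: lt0r_neq0|exact: scale_mulV].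
Qed.

Let deriv_z k : (k < n.+3)%N -> cderiv (fun u => z u k) t (vortex_rhs alpha n.+3
  xi (z t) k)^*.
Proof.
move=> kn; case: (ltnP k n) => [kn'|nk].
  apply: cderiv_ext (cderivD (cderiv_cst (y k) t) (deriv_ext kn')).
    by move=> u; rewrite /z /pos kn'.
  by rewrite add0r.
have [c c3 ->] : exists2 c, (c < 3)%N & k = (n + c)%N.
  by exists (k - n)%N; [rewrite ltn_subLR // addn3|rewrite subnKC].
rewrite vortex_rhs_cluster //.
case: c c3 => [|[|[|//]]] _ /=; rewrite ?addn0 ?addn1 ?addn2.
- apply: cderiv_ext (deriv_pos (f := f0) (k := n) deriv_v0 (G0E _ _)).
    by move=> u; rewrite /z pos0.
  rewrite rmorphD addrC conj_scaled; congr (_ + _^*).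
  rewrite /f0 /field0 /z pos0 pos1 pos2 !kernel_pos.
  by move: (kernel _ _) (kernel _ _) (_ * (_^-1)%:C) => k1 k2 k3; ring.
- apply: cderiv_ext (deriv_pos (f := f1) (k := n.+1) deriv_v1 (G1E _ _)).
    by move=> u; rewrite /z pos1.
  rewrite rmorphD addrC conj_scaled; congr (_ + _^*).
  rewrite /f1 /field1 /z pos0 pos1 pos2 !kernel_pos.
  by move: (kernel _ _) (kernel _ _) (_ * (_^-1)%:C) => k1 k2 k3; ring.
- apply: cderiv_ext (deriv_pos (f := f2) (k := n.+2) deriv_v2 (G2E _ _)).
    by move=> u; rewrite /z pos2.
  rewrite rmorphD addrC conj_scaled; congr (_ + _^*).
  rewrite /f2 /field2 /z pos0 pos1 pos2 !kernel_pos.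
  by move: (kernel _ _) (kernel _ _) (_ * (_^-1)%:C) => k1 k2 k3; ring.
Qed.

Lemma cluster_curve_deriv k : (k < n.+3)%N ->
  cderiv (fun u => z u k) t (vortex_rhs alpha n.+3 xi (z t) k)^*.
Proof. exact: deriv_z. Qed.

End AlongCurve.

Lemma burst_curve : exists2 T, 0 < T & exists z : R -> nat -> R[i],
  [/\ forall t, 0 < t < T -> forall j k : 'I_n.+3, j != k -> z t j != z t k,
      forall t, 0 < t < T -> forall k, (k < n.+3)%N ->
        cderiv (fun u => z u k) t (vortex_rhs alpha n.+3 xi (z t) k)^* &
      forall k, (k < n.+3)%N -> forall e, 0 < e ->
        \forall t \near 0^'+, normc (z t k - y (minn k n)) <= e].
Proof.
have [T1 T10 [m hm]] := state_curve.
have [T2 T20 hT2] := near0_interval pos_distinct.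
pose T := Num.min T1 T2.
have inT t : 0 < t < T -> 0 < t < T1 /\ 0 < t < T2.
  by rewrite lt_min => /andP[-> /andP[-> ->]].
exists T; first by rewrite lt_min T10.
exists (fun t k => pos k t (m t)); split.
- move=> t /inT[t1 t2] j k jk; rewrite -subr_eq0.
  by apply: hT2 => //; exact: (hm t t1).1.
- move=> t /inT[t1 t2] k kn; apply: cluster_curve_deriv => //;
  first by case/andP : t1.
  exact: (hm t t1).2.
- move=> k kn e e0; have [_ tk _] := regular_pos kn.
  have nT : \forall t \near 0^'+, t < T1 by exact: nbhs_right_lt.
  apply: filterS3 (near0_gt0 R) nT (tk e e0) => t t0 tT h; apply: h.
  by apply: (hm t _).1; rewrite t0.
Qed.

End Burst.

(** * From curves indexed by natural numbers to bursts and collapses *)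

Section Assembly.
Variable R : realType.

(** The kernel commutes with conjugation but the factor i changes sign; reversing time restores
    it. *)
Lemma vortex_rhs_conj (alpha : R) n xi (z : nat -> R[i]) j :
  vortex_rhs alpha n xi (fun k => (z k)^*) j = - (vortex_rhs alpha n xi z j)^*.
Proof.
rewrite /vortex_rhs rmorphM /= rmorph_sum /=.
rewrite (eq_bigr (fun k : 'I_n => ((xi k)%:C * kernel alpha (z j - z k))^*));
  last first.
  by move=> k _; rewrite rmorphM /= conj_real -kernel_conj rmorphB.
by rewrite rmorphM /= conj_real conjCi; ring.
Qed.

Lemma cderiv_opp (f : R -> R[i]) t v : cderiv f (- t) v ->
  cderiv (fun u => f (- u)) t (- v).
Proof.
have dN : is_derive t 1 (fun u : R => - u) (-1).
  by apply: is_derive_ext (is_deriveN (is_derive_id t 1)).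
move=> [f1 f2]; split.
  apply: is_derive_ext (is_derive1_comp (g := fun u : R => - u) f1 dN) => //.
  by rewrite mulrN1 ReN.
apply: is_derive_ext (is_derive1_comp (g := fun u : R => - u) f2 dN) => //.
by rewrite mulrN1 ImN.
Qed.

Lemma normc_cvg (F : set_system R) (FF : Filter F) (f : R -> R[i]) w :
  (forall e, 0 < e -> \forall t \near F, normc (f t - w) <= e) ->
  (f t : R[i]^o) @[t --> F] --> (w : R[i]^o).
Proof.
move=> h; apply/cvgrPdist_le => e e0.
have eR : e = (complex.Re e)%:C by rewrite RRe_real // gtr0_real.
have e0' : 0 < complex.Re e by move: e0; rewrite eR ltcR.
by apply: filterS (h _ e0') => t ht; rewrite distrC normcE eR lecR.
Qed.

Lemma burst_data n (alpha : R) (y : 'I_(n.+3 - 2) -> R[i]) (zeta : 'I_(n.+3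
  - 2) -> R) :
  alpha < 3 -> hypothesisA alpha -> injective y -> (forall k, zeta k != 0) ->
  exists (T : R) (xi : nat -> R) (z : R -> nat -> R[i]),
    [/\ 0 < T /\ (forall j : 'I_n.+3, xi j != 0),
        splits_intensity zeta (fun j : 'I_n.+3 => xi j),
        forall t, 0 < t < T -> injective (fun j : 'I_n.+3 => z t j),
        forall t, 0 < t < T -> forall j : 'I_n.+3,
          cderiv (fun u => z u j) t (vortex_rhs alpha n.+3 xi (z t) j)^* &
        forall (j : 'I_n.+3) (k : 'I_(n.+3 - 2)), k = minn j (n.+3
          - 3) :> nat ->
          forall e, 0 < e -> \forall t \near 0^'+, normc (z t j - y k) <= e].
Proof.
move=> alpha3 hA y_inj zeta0.
have N3 : (n.+3 - 3)%N = n by rewrite -addn3 addnK.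
(* The bound n.+3 - 2 computes to n.+1, so [inord] applies without a cast. *)
pose ord k : 'I_(n.+3 - 2) := (inord k : 'I_n.+1).
have ordK k : (k <= n)%N -> ord k = k :> nat by move=> kn;
  rewrite /ord /= inordK.
(* The last vortex is the one that splits; its nonzero intensity becomes the total intensity of the
   cluster. *)
have [q [x [a [b [[q_inj q0] [x0 xsum] a0 hF _]]]]] := hA (zeta (ord n)) (zeta0
  _).
have {}hF c : (c < 3)%N -> nth (fun _ _ _ => 0)
      [:: field0 alpha (c_ alpha) (x (inord 1)) (x (inord 2));
          field1 alpha (c_ alpha) (x (inord 0)) (x (inord 2));
          field2 alpha (c_ alpha) (x (inord 0)) (x (inord 1))] c
      (q (inord 0)) (q (inord 1)) (q (inord 2)) = (q (inord c))^* * (a -i* b).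
  move=> c3; rewrite -hF.
  rewrite (@pv_rhsE _ _ _ _ _ (fun k => x (inord k)) (fun k => q (inord k)));
    first last.
  - by move=> k; rewrite /= inord_val.
  - by move=> k; rewrite /= inord_val.
  rewrite (inordK c3) -[c in vortex_rhs _ _ _ _ c]add0n vortex_rhs_cluster //
    big_ord0.
  by rewrite mulr0 add0r.
have q_neq i j : (i < 3)%N -> (j < 3)%N -> i != j -> q (inord i) != q (inord j).
  move=> i3 j3; apply: contra => /eqP/q_inj/(congr1 val) /=.
  by rewrite !inordK // => ->.
pose xi k := if (k < n)%N then zeta (ord k)
  else nth 0 [:: x (inord 0); x (inord 1); x (inord 2)] (k - n).
have xi0 : xi n = x (inord 0) by rewrite /xi ltnn subnn.
have xi1 : xi n.+1 = x (inord 1) by rewrite /xi ltnNge leqnSn subSnn.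
have xi2 : xi n.+2 = x (inord 2) by rewrite /xi ltnNge leqW // -addn2 addKn.
have xi_neq0 (j : 'I_n.+3) : xi j != 0.
  rewrite /xi; case: ltnP => // nj.
  have : (j - n < 3)%N by rewrite ltn_subLR // addn3.
  by case: (j - n)%N => [|[|[|//]]] _ /=; exact: x0.
have yord j k : (j <= n)%N -> (k <= n)%N -> y (ord j) = y (ord k) -> j = k.
  by move=> jn kn /y_inj/(congr1 val) /=; rewrite !ordK.
have q01 : q (inord 0) != q (inord 1) by exact: q_neq.
have q02 : q (inord 0) != q (inord 2) by exact: q_neq.
have q12 : q (inord 1) != q (inord 2) by exact: q_neq.
have [||||||T T0 [z [z1 z2 z3]]] := @burst_curve R n alpha a b xi (y \o ord)
  (q (inord 0)) (q (inord 1)) (q (inord 2)) alpha3 a0 q0 q01 q02 q12 yord.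
- by rewrite xi1.
- by rewrite xi2.
- by rewrite xi0 xi1 xi2 xsum.
- by rewrite xi1 xi2; exact: (hF 0).
- by rewrite xi0 xi2; exact: (hF 1).
- by rewrite xi0 xi1; exact: (hF 2).
exists T, xi, z; split => //.
- split=> [k j kn jk|k kn].
    have kn' : (k < n)%N by move: kn; rewrite N3.
    rewrite /xi jk kn'; congr (zeta _); apply: val_inj.
    by rewrite /= -[RHS]/(ord k : nat) ordK // ltnW.
  have -> : zeta k = x (inord 0) + x (inord 1) + x (inord 2).
    rewrite xsum; congr (zeta _); apply: val_inj.
    by rewrite /= -[RHS]/(ord n : nat) ordK // kn N3.
  rewrite big_mkcond !big_ord_recr /= N3 /= big1 ?add0r; last first.
    by move=> i _; rewrite leqNgt ltn_ord.
  have n2 : (n <= n.+2)%N by exact: leqW.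
  by rewrite leqnn leqnSn n2 xi0 xi1 xi2.
- by move=> t tT j k /= /eqP; apply: contraTeq => /z1 -> .
- by move=> t tT j; exact: z2.
- move=> j k jk e e0; have := z3 j (ltn_ord j) e e0.
  rewrite /= (_ : ord (minn j n) = k) //; apply: val_inj.
  by rewrite -[LHS]/(ord _ : nat) ordK ?geq_minr // -[RHS]/(k : nat) jk N3.
Qed.

Lemma burst_of_vortices n (alpha : R) (y : 'I_(n.+3 - 2) -> R[i])
    (zeta : 'I_(n.+3 - 2) -> R) :
  alpha < 3 -> hypothesisA alpha -> injective y -> (forall k, zeta k != 0) ->
  admits_burst alpha y zeta.
Proof.
move=> alpha3 hA y_inj zeta0.
have [T [xi [z [[T0 xi0] hs zinj dz lz]]]] := burst_data alpha3 hA y_inj zeta0.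
exists T, (fun j => xi j), (fun t j => z t j); split => //.
- move=> t; rewrite /= in_itv /= => tT; split; first exact: zinj.
  move=> j; rewrite (@pv_rhsE _ _ _ _ _ xi (z t)) //.
  apply: cderiv_time_derive; rewrite -[vortex_rhs _ _ _ _ _]conjCK.
  exact: cderiv_conj (dz t tT j).
- move=> j k jk; apply: normc_cvg; exact: lz.
Qed.

(* Time reversal composed with complex conjugation preserves (PV). *)
Lemma collapse_of_vortices n (alpha : R) (y : 'I_(n.+3 - 2) -> R[i])
    (zeta : 'I_(n.+3 - 2) -> R) :
  alpha < 3 -> hypothesisA alpha -> injective y -> (forall k, zeta k != 0) ->
  admits_collapse alpha y zeta.
Proof.
move=> alpha3 hA y_inj zeta0.
(* The burst is produced at the conjugate positions, so that conjugating it back gives the limits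
   [y]. *)
have yc_inj : injective (fun k => (y k)^*) by move=> j k /(inv_inj (@conjCK
  _))/y_inj.
have [T [xi [z [[T0 xi0] hs zinj dz lz]]]] := burst_data alpha3 hA yc_inj zeta0.
exists T, (fun j => xi j), (fun t j => (z (- t) j)^*); split => //.
- move=> t; rewrite /= in_itv /= => tT.
  have {}tT : 0 < - t < T by rewrite oppr_gt0 ltrNl andbC.
  split; first by move=> j k /(inv_inj (@conjCK _)) /zinj; apply.
  move=> j; rewrite (@pv_rhsE _ _ _ _ _ xi (fun k => (z (- t) k)^*)) //.
  rewrite vortex_rhs_conj; apply: cderiv_time_derive.
  apply: cderiv_ext (cderiv_opp (dz _ tT j)) => // u.
  by rewrite conjCK.
- move=> j k jk; apply: normc_cvg => e e0.
  have [T' T'0 h] := near0_interval (lz j k jk e e0).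
  near=> t; have tT : 0 < - t < T'.
    rewrite oppr_gt0 ltrNl; apply/andP; split.
      by near: t; exact: nbhs_left_lt.
    by near: t; apply: nbhs_left_gt; rewrite oppr_lt0.
  by have := h _ tT; rewrite -normc_conj rmorphB /= conjCK.
Unshelve. all: by end_near.
Qed.

End Assembly.

Theorem theorem1p2 (R : realType) (N : nat) (hN : (3 <= N)%N)
    (alpha : R) (halpha0 : 0 < alpha) (halpha3 : alpha < 3)
    (halpha2 : alpha != 2) (hA : hypothesisA alpha)
    (y : 'I_(N - 2) -> R[i]) (hy : injective y)
    (zeta : 'I_(N - 2) -> R) (hzeta : forall k, zeta k != 0) :
  admits_burst alpha y zeta /\ admits_collapse alpha y zeta.
Proof.
case: N hN y hy zeta hzeta => [|[|[|n]]] // _ y hy zeta hzeta.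
by split; [exact: burst_of_vortices|exact: collapse_of_vortices].
Qed.
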